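(* Fix an integer $k_{IJ}\ge 1$ and fixed finite constants $C_{op}>0$, $\rho\in(0,1)$ and $M_1,\dots,M_{k_{IJ}+1}\ge 0$, and put $\tilde C_{op}:=\frac{1}{1-\rho}C_{op}$. Consider a family of instances, each instance consisting of $N$, functions $g_0,\dots,g_N$, a weight vector $w\in\mathbb{R}^N$, the set $\Omega_w$, a set $\Omega_\theta\subseteq\mathbb{R}^D$ and constants $\delta_0,\dots,\delta_{k_{IJ}+1}\ge 0$, such that for every instance: (1) for each $\tilde w\in\Omega_w$ there is a solution $\hat\theta(\tilde w)$ of $G(\hat\theta(\tilde w),\tilde w)=0$ (one being fixed for each $\tilde w$), and $\Omega_\theta$ is an open set which, for some $\epsilon>0$, contains every point at Euclidean distance less than $\epsilon$ from the convex hull of $\{\hat\theta(\tilde w):\tilde w\in\Omega_w\}$; (2) $g_0,\dots,g_N$ are $k_{IJ}+1$ times continuously differentiable on $\Omega_\theta$; (3) $H(\theta,1_N)$ is symmetric positive definite for all $\theta\in\Omega_\theta$ and $\sup_{\theta\in\Omega_\theta}\|H(\theta,1_N)^{-1}\|_{op}\le C_{op}$; (4) $\sup_{\theta\in\Omega_\theta}\|d_\theta^kG(\theta,1_N)\|_2\le M_k$ for $1\le k\le k_{IJ}+1$; (5) $\sup_{\tilde w\in\Omega_w}\sup_{\theta\in\Omega_\theta}\|d_\theta^kG(\theta,\tilde w)-d_\theta^kG(\theta,1_N)\|_2\le\delta_k$ for $0\le k\le k_{IJ}+1$; (6) $C_{op}\delta_1+C_{op}^2M_2\delta_0\le\rho$.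 Let $\delta:=\max\{\delta_0,\dots,\delta_{k_{IJ}+1}\}$. Then, for every $k=0,\dots,k_{IJ}$, as $\delta\to0$ (with $\tilde C_{op}$ and the $M_k$ held fixed), $$\sup_{\tilde w\in\Omega_w}\big\|\delta_w^{k+1}\hat\theta(\tilde w)\big\|_2=O(\delta^{k+1})\qquad\text{and}\qquad\big\|\hat\theta^{IJ}_k(w)-\hat\theta(w)\big\|_2=O(\delta^{k+1}).$$
   Context: For $N,D\ge1$, functions $g_0,g_1,\dots,g_N$ with values in $\mathbb{R}^D$ of a variable $\theta\in\mathbb{R}^D$ (defined at least on $\Omega_\theta$), and $w\in\mathbb{R}^N$, set $G(\theta,w):=\frac1N\big(g_0(\theta)+\sum_{n=1}^Nw_ng_n(\theta)\big)$. $1_N$ is the all-ones vector of length $N$. $d_\theta^kG(\theta,w)$ is the array of the $D^{k+1}$ partial derivatives of order $k$ of $G$ in $\theta$, with $d_\theta^0G=G$, and $H(\theta,w):=d_\theta^1G(\theta,w)$, a $D\times D$ matrix. $\|\cdot\|_2$ of an array is the Euclidean norm of its vectorization; $\|\cdot\|_{op}$ is the matrix operator norm dual to the Euclidean vector norm. For a fixed $w$ and a fixed (arbitrarily small) scalar $\varepsilon>0$, $\Omega_w:=\{\tilde w\in\mathbb{R}^N:\|\tilde w-((1-t)1_N+tw)\|_2<\varepsilon\text{ for some }t\in[0,1]\}$. Write $\hat\theta:=\hat\theta(1_N)$ and $\Delta w:=w-1_N$. Under the listed hypotheses $\tilde w\mapsto\hat\theta(\tilde w)$ is $k_{IJ}+1$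 times continuously differentiable on $\Omega_w$. The $k$-th directional derivative in the direction $\Delta w$ is $$\delta_w^k\hat\theta(\tilde w):=\sum_{n_1=1}^N\cdots\sum_{n_k=1}^N\frac{\partial^k\hat\theta(w')}{\partial w'_{n_1}\cdots\partial w'_{n_k}}\Big|_{w'=\tilde w}\Delta w_{n_1}\cdots\Delta w_{n_k}.$$ The $k$-th order infinitesimal jackknife is $\hat\theta^{IJ}_k(w):=\hat\theta+\sum_{j=1}^k\frac1{j!}\delta_w^j\hat\theta(1_N)$, with $\hat\theta^{IJ}_0(w)=\hat\theta$. The dimension $D$ is fixed. *)

(* Defs.v *)
(* Vectors of R^n are row vectors of type 'rV[R]_n. *)
From HB Require Import structures.
From mathcomp Require Import all_boot all_order all_algebra.
From mathcomp Require Import all_classical all_reals all_analysis.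

Set Implicit Arguments.
Unset Strict Implicit.
Unset Printing Implicit Defensive.

Import Order.TTheory GRing.Theory Num.Theory.
Import numFieldNormedType.Exports.

Local Open Scope classical_set_scope.
Local Open Scope ring_scope.

Definition l2norm (R : realType) (I : finType) (a : I -> R) : R :=
  Num.sqrt (\sum_i a i ^+ 2).

(* The library norm `|x| of a matrix is the max norm; the topology is the
   same as that of the Euclidean norm below. *)
Definition enorm (R : realType) (m n : nat) (A : 'M[R]_(m, n)) : R :=
  l2norm (fun p : 'I_m * 'I_n => A p.1 p.2).

(* [sup] is the supremum in R: the set below is nonempty and bounded. *)
Definition opnorm (R : realType) (m n : nat) (A : 'M[R]_(m, n)) : R :=
  sup [set enorm (A *m x) | x in [set x : 'cV[R]_n | enorm x <= 1]].

Definition sym_posdef (R : realType) (n : nat) (A : 'M[R]_n) : Prop :=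
  A^T = A /\ forall x : 'cV[R]_n, x != 0 -> 0 < (x^T *m A *m x) 0 0.

Definition convex_hull (R : realType) (n : nat) (A : set 'rV[R]_n) :
    set 'rV[R]_n :=
  smallest (@convex_set R 'rV[R]_n) A.

Section Partial.
Variables (R : realType) (m n : nat).
Implicit Types f : 'rV[R]_m -> 'rV[R]_n.

(* For s = [:: i1; ...; ik]: d^k f / (dx_i1 ... dx_ik).  ['D_v] is total and
   has its intended value only where the limit exists, see [Ck_on]. *)
Definition pderiv (s : seq 'I_m) f : 'rV[R]_m -> 'rV[R]_n :=
  foldr (fun i h => 'D_(delta_mx 0 i) h) f s.

(* Only used for open A. *)
Definition Ck_on (k : nat) (A : set 'rV[R]_m) f : Prop :=
  (forall s : seq 'I_m, (size s < k)%N -> forall (i : 'I_m) x, A x ->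
     derivable (pderiv s f) x (delta_mx 0 i)) /\
  (forall s : seq 'I_m, (size s <= k)%N -> forall x, A x ->
     {for x, continuous (pderiv s f)}).

Definition darray (k : nat) f (x : 'rV[R]_m) :
    {ffun k.-tuple 'I_m * 'I_n -> R} :=
  [ffun p : k.-tuple 'I_m * 'I_n => pderiv p.1 f x 0 p.2].

Definition dirderiv (k : nat) (v : 'rV[R]_m) f (x : 'rV[R]_m) : 'rV[R]_n :=
  \sum_(s : k.-tuple 'I_m) (\prod_(i <- s) v 0 i) *: pderiv s f x.

End Partial.

(* Functions are total; outside [Omega_theta] (for [gfun]) and outside
   [Omega_w] (for [theta_hat]) their values are irrelevant. *)
Record instance (R : realType) (D : nat) := Instance {
  nobs : nat;
  gfun : 'I_nobs.+1 -> 'rV[R]_D -> 'rV[R]_D;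
  wgt : 'rV[R]_nobs;
  eps : R;
  Omega_theta : set 'rV[R]_D;
  theta_hat : 'rV[R]_nobs -> 'rV[R]_D;
  delta_ : nat -> R
}.

Arguments gfun {R D} X i theta : rename.
Arguments theta_hat {R D} X u : rename.

Section Instance.
Variables (R : realType) (D : nat) (X : instance R D).
Let N := nobs X.

Definition ones : 'rV[R]_N := const_mx 1.

Definition G (theta : 'rV[R]_D) (w : 'rV[R]_N) : 'rV[R]_D :=
  N%:R^-1 *: (gfun X ord0 theta +
              \sum_(n < N) w 0 n *: gfun X (lift ord0 n) theta).

Definition dG (k : nat) (theta : 'rV[R]_D) (w : 'rV[R]_N) :=
  darray k (G ^~ w) theta.

Definition H (theta : 'rV[R]_D) (w : 'rV[R]_N) : 'M[R]_D :=
  \matrix_(i, j) pderiv [:: j] (G ^~ w) theta 0 i.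

Definition Omega_w : set 'rV[R]_N :=
  [set u | exists t : R, 0 <= t <= 1 /\
     enorm (u - ((1 - t) *: ones + t *: wgt X)) < eps X].

Definition Delta_w : 'rV[R]_N := wgt X - ones.

Definition theta_IJ (k : nat) : 'rV[R]_D :=
  theta_hat X ones +
  \sum_(1 <= j < k.+1) j`!%:R^-1 *: dirderiv j Delta_w (theta_hat X) ones.

Definition delta_max (kIJ : nat) : R :=
  \big[Num.max/0]_(j < kIJ.+2) delta_ X j.

Record admissible (kIJ : nat) (Cop rho : R) (M : nat -> R) : Prop := {
  adm_N : (1 <= N)%N;
  adm_eps : 0 < eps X;
  adm_delta_ge0 : forall k, (k <= kIJ.+1)%N -> 0 <= delta_ X k;
  adm_root : forall u, Omega_w u -> G (theta_hat X u) u = 0;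
  adm_open : open (Omega_theta X);
  adm_hull : exists2 e : R, 0 < e &
    forall x y, convex_hull [set theta_hat X u | u in Omega_w] y ->
      enorm (x - y) < e -> Omega_theta X x;
  adm_smooth : forall n, Ck_on kIJ.+1 (Omega_theta X) (gfun X n);
  adm_posdef : forall theta, Omega_theta X theta -> sym_posdef (H theta ones);
  adm_Cop : (ereal_sup [set (opnorm (invmx (H theta ones)))%:E
                       | theta in Omega_theta X] <= Cop%:E)%E;
  adm_M : forall k, (1 <= k <= kIJ.+1)%N ->
    (ereal_sup [set (l2norm (dG k theta ones))%:E
               | theta in Omega_theta X] <= (M k)%:E)%E;
  adm_delta : forall k, (k <= kIJ.+1)%N ->
    (ereal_sup [set ereal_sup [set (l2norm (dG k theta u - dG k theta ones))%:E
                              | theta in Omega_theta X]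
               | u in Omega_w] <= (delta_ X k)%:E)%E;
  adm_rho : Cop * delta_ X 1%N + Cop ^+ 2 * M 2%N * delta_ X 0%N <= rho
}.

End Instance.

Arguments ones {R D} X.
Arguments G {R D} X theta w.
Arguments dG {R D} X k theta w.
Arguments H {R D} X theta w.
Arguments Omega_w {R D} X.
Arguments Delta_w {R D} X.
Arguments theta_IJ {R D} X k.
Arguments delta_max {R D} X kIJ.
Arguments admissible {R D} X kIJ Cop rho M.

(* Main.v *)
Require Import Defs.
From mathcomp Require Import all_boot all_order all_algebra.
From mathcomp Require Import all_classical all_reals all_analysis.
From mathcomp Require Import ring lra.
Import Order.TTheory GRing.Theory Num.Theory.
Import numFieldNormedType.Exports.
Local Open Scope classical_set_scope.
Local Open Scope ring_scope.

Set Implicit Arguments.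
Unset Strict Implicit.
Unset Printing Implicit Defensive.

(** Write [theta] for the root map, [G_u = G(., u)], [Delta = w - 1] and
    [Gam = G_w - G_1]. As [G] is affine in the weights, moving [u] by
    [t Delta] adds [t Gam] to [G_u], and the derivatives of [Gam] on
    [Omega_theta] are bounded by [delta].

    The root map is well behaved because [G_u] is strongly monotone.
    Positive definiteness and the bound on the inverse give
    [x^T H(th, 1) x >= |x|^2 / Cop] ([posdef_coercive]). Since
    [H(th, u)] is within [delta_1 <= rho / Cop] of [H(th, 1)], it satisfies the
    same inequality with the constant [(1 - rho) / Cop] ([H_coercive]).
    Integrating along the segment between two points [a] and [b] of the convex
    hull of the roots gives
    [(a - b) . (G_u a - G_u b) >= (1 - rho) / Cop * |a - b|^2]
    ([G_monotone]); hence [theta] is Lipschitz at each [u], and expanding the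
    equation to first order ([theta_differentiable]) gives
      [d theta (v) = - H^-1 * (1 / N) * sum_n v_n g_n(theta)].

    The right-hand side is made of entries of [H^-1] and of partial
    derivatives of [G] at the root, and so is its derivative in any direction.
    Higher derivatives of [theta] are therefore values of formal expressions
    ([expr], [dexpr], [droots]) in these atoms. Since an expression of order
    at most [kIJ] has a derivative and one of order at most [kIJ + 1] is
    continuous ([interp_is_derive], [continuous_interp]), [theta] is of class
    C^(kIJ + 1) ([theta_Ck]).

    The expression of the derivative of order [k + 1] in one direction does
    not depend on the instance, so a bound on its atoms bounds it uniformly
    over all instances ([interp_bound]). In the direction [Delta / delta] the
    atoms are bounded by the constants: those built from the direction are
    derivatives of [Gam / delta], bounded by [1], the other derivatives of [G]
    are bounded by [M_j + delta], and the entries of [H^-1] by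
    [Cop / (1 - rho)]. A derivative of order [k + 1] is homogeneous of degree
    [k + 1] in the direction, and this is where the factor [delta^(k + 1)]
    comes from ([dirderiv_bound]). Taylor's formula on the segment from [1] to
    [w] then bounds the error of the infinitesimal jackknife
    ([theta_IJ_error]). *)

(** * Euclidean norms *)

Section L2norm.
Variables (R : realType) (I : finType).
Implicit Types a b : I -> R.

Lemma sumsq_ge0 a : 0 <= \sum_i a i ^+ 2.
Proof. by apply: sumr_ge0 => i _; exact: sqr_ge0. Qed.

Lemma l2norm_ge0 a : 0 <= l2norm a.
Proof. exact: sqrtr_ge0. Qed.

Lemma sqr_l2norm a : l2norm a ^+ 2 = \sum_i a i ^+ 2.
Proof. by rewrite sqr_sqrtr// sumsq_ge0. Qed.

Lemma normr_le_l2norm a i : `|a i| <= l2norm a.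
Proof.
rewrite -sqrtr_sqr ler_sqrt ?sumsq_ge0//.
by rewrite (bigD1 i)//= lerDl sumr_ge0// => j _; exact: sqr_ge0.
Qed.

Lemma l2norm_le_sum a : l2norm a <= \sum_i `|a i|.
Proof.
rewrite -(@ler_pXn2r _ 2)// ?nnegrE ?l2norm_ge0 ?sumr_ge0//.
rewrite sqr_l2norm expr2 mulr_suml ler_sum// => i _.
rewrite -real_normK ?num_real// expr2 ler_wpM2l//.
by rewrite (bigD1 i)//= lerDl sumr_ge0.
Qed.

Lemma l2norm0P a : l2norm a = 0 -> forall i, a i = 0.
Proof.
by move=> a0 i; apply/eqP; rewrite -normr_le0 -a0; exact: normr_le_l2norm.
Qed.

(** Cauchy-Schwarz, from [2 x y <= x ^+ 2 + y ^+ 2] at the rescaled terms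
    [x = |b| a i] and [y = |a| b i]. *)
Lemma l2norm_cs a b : \sum_i a i * b i <= l2norm a * l2norm b.
Proof.
have [a0|a0] := eqVneq (l2norm a) 0.
  by rewrite a0 mul0r big1// => i _; rewrite (l2norm0P a0) mul0r.
have [b0|b0] := eqVneq (l2norm b) 0.
  by rewrite b0 mulr0 big1// => i _; rewrite (l2norm0P b0) mulr0.
have ap : 0 < l2norm a by rewrite lt_def a0 l2norm_ge0.
have bp : 0 < l2norm b by rewrite lt_def b0 l2norm_ge0.
have : \sum_i (2 * (l2norm a * l2norm b)) * (a i * b i) <=
       \sum_i (l2norm b ^+ 2 * a i ^+ 2 + l2norm a ^+ 2 * b i ^+ 2).
  apply: ler_sum => i _; rewrite -subr_ge0.
  have -> : l2norm b ^+ 2 * a i ^+ 2 + l2norm a ^+ 2 * b i ^+ 2 -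
    2 * (l2norm a * l2norm b) * (a i * b i) =
    (l2norm b * a i - l2norm a * b i) ^+ 2 by ring.
  exact: sqr_ge0.
rewrite -mulr_sumr big_split/= -!mulr_sumr -!sqr_l2norm => h.
rewrite -(@ler_pM2l _ (2 * (l2norm a * l2norm b))) ?mulr_gt0//.
by apply: le_trans h _; rewrite le_eqVlt; apply/orP; left; apply/eqP; ring.
Qed.

Lemma l2normD a b : l2norm (fun i => a i + b i) <= l2norm a + l2norm b.
Proof.
rewrite -(@ler_pXn2r _ 2)// ?nnegrE ?addr_ge0 ?l2norm_ge0//.
rewrite sqr_l2norm sqrrD !sqr_l2norm.
have -> : \sum_i (a i + b i) ^+ 2 =
    \sum_i a i ^+ 2 + (\sum_i a i * b i) *+ 2 + \sum_i b i ^+ 2.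
  rewrite -mulr_natl mulr_sumr -!big_split/=.
  by apply: eq_bigr => i _; ring.
by rewrite lerD2r lerD2l lerMn2r l2norm_cs.
Qed.

End L2norm.

Section Enorm.
Variable R : realType.

Lemma enorm_ge0 m n (A : 'M[R]_(m, n)) : 0 <= enorm A.
Proof. exact: l2norm_ge0. Qed.

Lemma enorm0 m n : enorm (0 : 'M[R]_(m, n)) = 0.
Proof.
by rewrite /enorm /l2norm big1 ?sqrtr0// => i _; rewrite mxE expr0n.
Qed.

Lemma enorm0P m n (A : 'M[R]_(m, n)) : enorm A = 0 -> A = 0.
Proof.
by move=> A0; apply/matrixP => i j; rewrite mxE (l2norm0P A0 (i, j)).
Qed.

Lemma normr_le_enorm m n (A : 'M[R]_(m, n)) i j : `|A i j| <= enorm A.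
Proof. exact: (@normr_le_l2norm _ _ (fun p => A p.1 p.2) (i, j)). Qed.

Lemma mxnorm_le_enorm m n (A : 'M[R]_(m, n)) : `|A| <= enorm A.
Proof.
rewrite [leLHS]/Num.Def.normr/= mx_normrE.
by apply: bigmax_le => [|i _]; [exact: enorm_ge0|exact: normr_le_enorm].
Qed.

Lemma entry_le_mxnorm m n (A : 'M[R]_(m, n)) i j : `|A i j| <= `|A|.
Proof.
rewrite [leRHS]/Num.Def.normr/= mx_normrE.
exact: (le_bigmax _ (fun p : 'I_m * 'I_n => `|A p.1 p.2|) (i, j)).
Qed.

Lemma enorm_le_mxnorm m n (A : 'M[R]_(m, n)) : enorm A <= (m * n)%:R * `|A|.
Proof.
apply: le_trans (l2norm_le_sum _) _.
apply: le_trans (_ : \sum_(i : 'I_m * 'I_n) `|A| <= _).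
  by apply: ler_sum => i _; exact: entry_le_mxnorm.
by rewrite sumr_const card_prod !card_ord mulr_natl.
Qed.

Lemma sqr_enormc n (x : 'cV[R]_n) : enorm x ^+ 2 = (x^T *m x) 0 0.
Proof.
rewrite sqr_l2norm mxE [LHS](reindex (fun i => (i, 0 : 'I_1)))/=; last first.
  by exists fst => // -[i j] _; rewrite /= [j]ord1.
by apply: eq_bigr => i _; rewrite !mxE.
Qed.

Lemma enorm_cs n (x y : 'cV[R]_n) : (x^T *m y) 0 0 <= enorm x * enorm y.
Proof.
apply: le_trans (l2norm_cs _ _).
rewrite mxE [leRHS](reindex (fun i => (i, 0 : 'I_1)))/=; last first.
  by exists fst => // -[i j] _; rewrite /= [j]ord1.
by rewrite ler_sum// => i _; rewrite !mxE.
Qed.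

Lemma enorm_trmx m n (A : 'M[R]_(m, n)) : enorm A^T = enorm A.
Proof.
rewrite /enorm /l2norm; congr Num.sqrt.
rewrite [RHS](reindex (fun p => (p.2, p.1)))/=; last first.
  by exists (fun p => (p.2, p.1)) => -[].
by apply: eq_bigr => i _; rewrite mxE.
Qed.

Lemma enormZ m n (a : R) (A : 'M[R]_(m, n)) : enorm (a *: A) = `|a| * enorm A.
Proof.
rewrite /enorm /l2norm -sqrtr_sqr -sqrtrM ?sqr_ge0// mulr_sumr.
by congr Num.sqrt; apply: eq_bigr => i _; rewrite mxE exprMn.
Qed.

Lemma enormD m n (A B : 'M[R]_(m, n)) : enorm (A + B) <= enorm A + enorm B.
Proof.
apply: le_trans (l2normD _ _); rewrite le_eqVlt; apply/orP; left; apply/eqP.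
by congr Num.sqrt; apply: eq_bigr => i _; rewrite mxE.
Qed.

Lemma enorm_mulmx m n (A : 'M[R]_(m, n)) (x : 'cV[R]_n) :
  enorm (A *m x) <= enorm A * enorm x.
Proof.
rewrite -(@ler_pXn2r _ 2)// ?nnegrE ?enorm_ge0 ?mulr_ge0 ?enorm_ge0//.
rewrite sqr_enormc mxE exprMn [X in _ <= X * _]sqr_l2norm.
rewrite -(pair_bigA _ (fun i j => A i j ^+ 2))/= mulr_suml.
apply: ler_sum => i _; rewrite mxE -expr2.
have -> : (A *m x) i 0 = ((row i A)^T^T *m x) 0 0.
  by rewrite trmxK !mxE; apply: eq_bigr => j _; rewrite !mxE.
have -> : \sum_j A i j ^+ 2 = enorm (row i A)^T ^+ 2.
  by rewrite sqr_enormc trmxK mxE; apply: eq_bigr => j _; rewrite !mxE.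
rewrite -exprMn -[X in X <= _]real_normK ?num_real//.
rewrite ler_pXn2r// ?nnegrE ?mulr_ge0 ?enorm_ge0//.
rewrite ler_norml enorm_cs andbT lerNl.
rewrite -mulN1r -[X in _ <= enorm X * _]scale1r.
have -> : -1 * ((row i A)^T^T *m x) 0 0 = ((- (row i A)^T)^T *m x) 0 0.
  by rewrite linearN/= mulNmx [in RHS]mxE mulN1r.
apply: le_trans (enorm_cs _ _) _.
by rewrite -scaleN1r !enormZ normrN normr1.
Qed.

Lemma opnorm_ub m n (A : 'M[R]_(m, n)) (x : 'cV[R]_n) :
  enorm (A *m x) <= opnorm A * enorm x.
Proof.
have [x0|x0] := eqVneq (enorm x) 0.
  by rewrite (enorm0P x0) mulmx0 !enorm0 mulr0.
have xp : 0 < enorm x by rewrite lt_def x0 enorm_ge0.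
rewrite -ler_pdivrMr//.
have -> : enorm (A *m x) / enorm x = enorm (A *m ((enorm x)^-1 *: x)).
  by rewrite -scalemxAr enormZ ger0_norm ?invr_ge0 ?enorm_ge0// mulrC.
apply: ub_le_sup.
  exists (enorm A) => _ [y /= y1 <-]; apply: le_trans (enorm_mulmx _ _) _.
  by rewrite ler_piMr ?enorm_ge0.
exists ((enorm x)^-1 *: x) => //=.
by rewrite enormZ ger0_norm ?invr_ge0 ?enorm_ge0// mulVf.
Qed.

End Enorm.

(** * Coercive matrices *)

Section Coercive.
Variables (R : realType) (n : nat).
Implicit Types (A B E : 'M[R]_n) (x : 'cV[R]_n).

Definition coercive (c : R) A :=
  forall x, c * enorm x ^+ 2 <= (x^T *m A *m x) 0 0.

Lemma inj_unitmx A : (forall x, A *m x = 0 -> x = 0) -> A \in unitmx.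
Proof.
move=> Ainj; rewrite -unitmx_tr -row_free_unit -kermx_eq0.
apply/eqP/row_matrixP => i; rewrite row0.
have : row i (kermx A^T) *m A^T = 0 by rewrite -row_mul mulmx_ker row0.
move=> /(congr1 trmx); rewrite trmx_mul trmxK trmx0 => /Ainj h.
by apply: trmx_inj; rewrite h trmx0.
Qed.

(** With [y = A^-1 x] one has [x^T A y = |x|^2] and
    [y^T A y = x^T y <= C |x|^2], so that expanding
    [0 <= (x - y / C)^T A (x - y / C)] gives the claim. *)
Lemma posdef_coercive (C : R) A : 0 < C -> sym_posdef A ->
  opnorm (invmx A) <= C -> coercive C^-1 A.
Proof.
move=> C0 [Asym Apos] AC x.
have Aker (v : 'cV[R]_n) : (A *m v = 0) -> v = 0.
  move=> Av; have [//|/Apos] := eqVneq v 0.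
  by rewrite -mulmxA Av mulmx0 mxE ltxx.
have Au := inj_unitmx Aker.
pose y := invmx A *m x.
have Ay : A *m y = x by rewrite mulmxA mulmxV// mul1mx.
have yA : y^T *m A = x^T by rewrite -[in LHS]Asym -trmx_mul Ay.
have yx : (x^T *m y) 0 0 <= C * enorm x ^+ 2.
  apply: le_trans (enorm_cs _ _) _.
  rewrite expr2 mulrA [C * _]mulrC -mulrA ler_wpM2l ?enorm_ge0//.
  apply: le_trans (opnorm_ub _ _) _.
  by rewrite ler_wpM2r ?enorm_ge0.
pose t := C^-1.
have : 0 <= ((x - t *: y)^T *m A *m (x - t *: y)) 0 0.
  have [->|z0] := eqVneq (x - t *: y) 0; last exact: ltW (Apos _ z0).
  by rewrite mulmx0 mxE.
have -> : (x - t *: y)^T *m A *m (x - t *: y) =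
  x^T *m A *m x - (2 * t) *: (x^T *m x) + t ^+ 2 *: (x^T *m y).
  have -> : (x - t *: y)^T = x^T - t *: y^T.
    by apply/matrixP => i j; rewrite !mxE.
  rewrite mulmxBl mulmxBr -!scalemxAl -!scalemxAr yA !mulmxBl -!scalemxAl.
  rewrite -(mulmxA _ A y) Ay.
  move: (x^T *m A *m x) (x^T *m x) (x^T *m y) => a b c.
  by apply/matrixP => i j; rewrite !mxE; ring.
have mx1E (a b c : 'M[R]_1) : (a - (2 * t) *: b + t ^+ 2 *: c) 0 0 =
    a 0 0 - 2 * t * b 0 0 + t ^+ 2 * c 0 0 by rewrite !mxE.
rewrite mx1E -sqr_enormc => h.
have : t ^+ 2 * (x^T *m y) 0 0 <= t * enorm x ^+ 2.
  apply: le_trans (ler_wpM2l (sqr_ge0 _) yx) _.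
  by rewrite expr2 mulrA -[t * t * C]mulrA mulVf ?gt_eqF// mulr1.
rewrite -/t; lra.
Qed.

(** [|x^T E x| <= |E| |x|^2] with [E = B - A] and its Euclidean norm. *)
Lemma coercive_perturb (c d : R) A B : coercive c A -> enorm (B - A) <= d ->
  coercive (c - d) B.
Proof.
move=> cA BA x.
have -> : (x^T *m B *m x) 0 0 =
    (x^T *m A *m x) 0 0 - ((- x)^T *m ((B - A) *m x)) 0 0.
  have -> : (- x)^T *m ((B - A) *m x) = x^T *m A *m x - x^T *m B *m x.
    by rewrite linearN/= mulNmx mulmxBl mulmxBr !mulmxA opprB.
  by move: (x^T *m A *m x) (x^T *m B *m x) => a b; rewrite !mxE; ring.
have := enorm_cs (- x) ((B - A) *m x).
rewrite -[X in enorm X * _]scaleN1r enormZ normrN normr1 mul1r => h.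
have := enorm_mulmx (B - A) x => h2.
have := ler_wpM2l (enorm_ge0 x) h2 => h3.
have := ler_wpM2r (sqr_ge0 (enorm x)) BA => h4.
have := cA x.
rewrite mulrBl; nra.
Qed.

Lemma coercive_lower (c : R) A x : coercive c A ->
  c * enorm x <= enorm (A *m x).
Proof.
move=> cA.
have [x0|x0] := eqVneq (enorm x) 0; first by rewrite x0 mulr0 enorm_ge0.
have xp : 0 < enorm x by rewrite lt_def x0 enorm_ge0.
rewrite -(ler_pM2l xp); apply: le_trans (enorm_cs _ _).
by rewrite mulmxA; apply: le_trans (cA x); rewrite expr2 mulrCA.
Qed.

Lemma coercive_unitmx (c : R) A : 0 < c -> coercive c A -> A \in unitmx.
Proof.
move=> c0 cA; apply: inj_unitmx => x Ax.
have := coercive_lower x cA; rewrite Ax enorm0 pmulr_rle0// => x0.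
by apply: enorm0P; apply/eqP; rewrite eq_le x0 enorm_ge0.
Qed.

Lemma coercive_invmx (c : R) A i j : 0 < c -> coercive c A ->
  `|invmx A i j| <= c^-1.
Proof.
move=> c0 cA; have Au := coercive_unitmx c0 cA.
have -> : invmx A i j = (invmx A *m delta_mx j 0) i (0 : 'I_1).
  by rewrite -colE mxE.
apply: le_trans (normr_le_enorm _ _ _) _.
rewrite -[leRHS]mulr1 ler_pdivlMl//.
apply: le_trans (coercive_lower _ cA) _.
rewrite mulmxA mulmxV// mul1mx.
apply: le_trans (l2norm_le_sum _) _.
rewrite (bigD1 (j, 0))//= big1 ?addr0 ?mxE ?eqxx ?normr1//.
move=> [k l]; rewrite mxE /= [l]ord1 xpair_eqE !eqxx andbT => /negPf ->.
by rewrite normr0.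
Qed.

End Coercive.

(** * Mean value theorem and Frechet differentiability *)

Section Line.
Variable R : realType.

Lemma is_derive_line (V W : normedModType R) (f : V -> W) (x v : V) (t : R) :
  derivable f (x + t *: v) v ->
  is_derive t 1 (fun s : R => f (x + s *: v)) ('D_v f (x + t *: v)).
Proof.
have E : (fun h : R => h^-1 *: (((fun s : R => f (x + s *: v)) \o shift t)
    (h *: (1 : R)) - f (x + t *: v))) =
  (fun h : R => h^-1 *: ((f \o shift (x + t *: v)) (h *: v) - f (x + t *: v))).
  apply/funext => h /=; congr (_ *: (f _ - _)).
  by rewrite /= scalerDl [h *: 1]mulr1 addrCA.
by move=> df; apply: DeriveDef; rewrite /derivable/derive E.
Qed.

Lemma is_derive_itv_continuous (f df : R -> R) (a b : R) :
  (forall x, a <= x <= b -> is_derive x 1 f (df x)) ->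
  {within `[a, b], continuous f}.
Proof.
move=> fdf; apply: derivable_within_continuous => x; rewrite in_itv/= => xab.
by have [] := fdf x xab.
Qed.

Lemma mvt_segment (f df : R -> R) (a b : R) : a <= b ->
  (forall x, a <= x <= b -> is_derive x 1 f (df x)) ->
  exists2 c, a <= c <= b & f b - f a = df c * (b - a).
Proof.
move=> ab fdf.
have fdf' (x : R) : x \in `]a, b[ -> is_derive x 1 f (df x).
  by rewrite in_itv/= => /andP[ax xb]; apply: fdf; rewrite !ltW.
have [c cab ->] := MVT_segment ab fdf' (is_derive_itv_continuous fdf).
by exists c => //; move: cab; rewrite in_itv.
Qed.

(** The increment along a coordinate may have either sign. *)
Lemma mvt0 (f df : R -> R) (b : R) :
  (forall x : R, `|x| <= `|b| -> is_derive x 1 f (df x)) ->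
  exists2 c, `|c| <= `|b| & f b - f 0 = df c * b.
Proof.
move=> fdf; have [b0|b0] := leP 0 b.
  have fdf' (x : R) : 0 <= x <= b -> is_derive x 1 f (df x).
    by move=> /andP[x0 xb]; apply: fdf; rewrite !ger0_norm.
  have [c /andP[c0 cb] ->] := mvt_segment b0 fdf'.
  by exists c; rewrite ?subr0// !ger0_norm.
have fdf' (x : R) : b <= x <= 0 -> is_derive x 1 f (df x).
  by move=> /andP[xb x0]; apply: fdf; rewrite (ltr0_norm b0) ler0_norm ?lerN2.
have [c /andP[cb c0] E] := mvt_segment (ltW b0) fdf'.
exists c; first by rewrite (ltr0_norm b0) ler0_norm ?lerN2.
by rewrite -[LHS]opprB E sub0r mulrN opprK.
Qed.

End Line.

Lemma near_normP (R : realType) (V : normedModType R) (x : V) (P : V -> Prop) :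
  (\forall y \near x, P y) <->
  exists2 d : R, 0 < d & forall y, `|y - x| < d -> P y.
Proof.
split=> [/nbhs_normP[d /= d0 dP]|[d d0 dP]].
  by exists d => // y yx; apply: dP; rewrite /= distrC.
by apply/nbhs_normP; exists d => //= y yx; apply: dP; rewrite distrC.
Qed.

Lemma differentiable_of_smallo (R : realType) (V W : normedModType R)
    (f : V -> W) (x : V) (L : {linear V -> W}) :
  continuous L ->
  (forall e : R, 0 < e -> \forall h \near (0 : V),
     `|f (h + x) - f x - L h| <= e * `|h|) ->
  differentiable f x /\ ('d f x = L :> (V -> W)).
Proof.
move=> Lc fL.
have fo : f \o shift x = cst (f x) + L +o_ 0 id.
  apply/eqaddoP => e e0; have := fL e e0; apply: filterS => h.
  by rewrite !fctE /= opprD addrA.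
have dE := diff_unique Lc fo.
by split=> //; apply/diff_locallyP; rewrite dE.
Qed.

Lemma near_translate (R : realType) (V : normedModType R) (x : V)
    (P : V -> Prop) :
  (\forall y \near x, P y) -> \forall h \near (0 : V), P (h + x).
Proof.
move=> /near_normP[d d0 dP]; apply/near_normP; exists d => // h.
by rewrite subr0 => hd; apply: dP; rewrite addrK.
Qed.

Lemma differentiable_smallo (R : realType) (V W : normedModType R)
    (f : V -> W) (x : V) (e : R) : differentiable f x -> 0 < e ->
  \forall y \near x, `|f y - f x - 'd f x (y - x)| <= e * `|y - x|.
Proof.
move=> /diff_locally/eqaddoP/(_ e) fd /fd /near_normP[d d0 dP].
apply/near_normP; exists d => // y yx; have := dP (y - x).
by rewrite subr0 => /(_ yx); rewrite !fctE /= subrK opprD addrA.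
Qed.

Lemma mxnorm_le (R : realType) m n (A : 'M[R]_(m, n)) (c : R) :
  0 <= c -> (forall i j, `|A i j| <= c) -> `|A| <= c.
Proof.
move=> c0 Ac; rewrite [leLHS]/Num.Def.normr/= mx_normrE.
by apply: bigmax_le => [//|i _]; exact: Ac.
Qed.

Lemma is_derive_entry (R : realType) (V : normedModType R) n
    (f : V -> 'rV[R]_n) (x v : V) (j : 'I_n) (df : 'rV[R]_n) :
  is_derive x v f df -> is_derive x v (fun y => f y 0 j) (df 0 j).
Proof.
move=> [fd <-]; rewrite (derive_mx fd) mxE; apply: DeriveDef => //.
exact: (derivable_mxP f x v).1 fd 0 j.
Qed.

Section Frechet.
Variables (R : realType) (m n : nat).
Implicit Types (f : 'rV[R]_m -> 'rV[R]_n) (x h : 'rV[R]_m).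

Lemma mulmx_norm_bound h (B : 'M[R]_(m, n)) :
  `|h *m B| <= enorm B * m%:R * `|h|.
Proof.
apply: le_trans (mxnorm_le_enorm _) _.
rewrite -enorm_trmx trmx_mul; apply: le_trans (enorm_mulmx _ _) _.
rewrite !enorm_trmx -mulrA ler_wpM2l ?enorm_ge0//.
by apply: le_trans (enorm_le_mxnorm _) _; rewrite mul1n.
Qed.

Lemma differentiable_of_smallo_mx f x (B : 'M[R]_(m, n)) :
  (forall e : R, 0 < e -> \forall h \near (0 : 'rV[R]_m),
     `|f (h + x) - f x - h *m B| <= e * `|h|) ->
  differentiable f x /\ forall h, 'd f x h = h *m B.
Proof.
move=> fB.
pose L : {linear 'rV[R]_m -> 'rV[R]_n} := mulmxr B.
have Lc : continuous L.
  apply/linear_bounded_continuous/linear_boundedP.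
  near=> r => h; apply: le_trans (mulmx_norm_bound _ _) _.
  by apply: ler_wpM2r => //; near: r; exact: nbhs_pinfty_ge.
by have [df dE] := differentiable_of_smallo Lc fB; split=> // h; rewrite dE.
Unshelve. all: by end_near. Qed.

Lemma diffE_row f x h : differentiable f x ->
  'd f x h = \sum_i h 0 i *: 'D_(delta_mx 0 i) f x.
Proof.
move=> df; rewrite [in LHS](row_sum_delta h) linear_sum.
by apply: eq_bigr => i _; rewrite linearZ deriveE.
Qed.

(** The increment [f (x + h) - f x] is telescoped along the coordinates, the
    mean value theorem being applied to one coordinate of [h] at a time. *)
Lemma continuous_partials_differentiable f x :
  (\forall y \near x, forall i, derivable f y (delta_mx 0 i)) ->
  (forall i, {for x, continuous ('D_(delta_mx 0 i) f)}) ->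
  differentiable f x.
Proof.
move=> fd fc.
pose B := \matrix_(i < m) 'D_(delta_mx 0 i) f x.
suff fB : forall e : R, 0 < e -> \forall h \near (0 : 'rV[R]_m),
     `|f (h + x) - f x - h *m B| <= e * `|h|.
  by have [] := differentiable_of_smallo_mx fB.
move=> e e0.
have e'0 : 0 < e / m.+1%:R by rewrite divr_gt0.
have : \forall y \near x, (forall i, derivable f y (delta_mx 0 i)) /\
   forall i, `|'D_(delta_mx 0 i) f y - 'D_(delta_mx 0 i) f x| <= e / m.+1%:R.
  near=> y; split; first by near: y.
  near: y; apply: filter_forall => i.
  have /cvgrPdist_le/(_ _ e'0) := fc i.
  by apply: filterS => y; rewrite distrC.
move=> /near_normP[d d0 dP]; apply/near_normP; exists d => // h.
rewrite subr0 => hd; apply: mxnorm_le => [|r j].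
  by rewrite mulr_ge0// ltW.
rewrite [r]ord1 {r}.
pose tr (k : nat) : 'rV[R]_m := \row_i (if (i < k)%N then h 0 i else 0).
pose F k := f (x + tr k) 0 j.
have tr0 : tr 0%N = 0 by apply/rowP => i; rewrite !mxE.
have trm : tr m = h by apply/rowP => i; rewrite !mxE ltn_ord.
have trS (k : 'I_m) : tr k.+1 = tr k + h 0 k *: delta_mx 0 k.
  apply/rowP => i; rewrite !mxE eqxx/= ltnS leq_eqVlt val_eqE.
  have [->|ik] := eqVneq i k; first by rewrite ltnn add0r mulr1.
  by rewrite mulr0 addr0.
have tr_le (k : 'I_m) (s : R) : `|s| <= `|h 0 k| ->
    `|x + (tr k + s *: delta_mx 0 k) - x| < d.
  move=> sh; rewrite addrC addKr; apply: le_lt_trans hd.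
  apply: mxnorm_le => // r i; rewrite [r]ord1 !mxE eqxx/=.
  have [->|ik] := eqVneq i k.
    by rewrite ltnn add0r mulr1 (le_trans sh)// entry_le_mxnorm.
  by rewrite mulr0 addr0; case: ifP => _; rewrite ?normr0// entry_le_mxnorm.
(* The increment along the k-th coordinate, from the k-th to the next
   truncation of h. *)
have step (k : 'I_m) : `|F k.+1 - F k - h 0 k * B k j| <= e / m.+1%:R * `|h|.
  pose dk (s : R) := 'D_(delta_mx 0 k) f (x + tr k + s *: delta_mx 0 k) 0 j.
  have dF (s : R) : `|s| <= `|h 0 k| -> is_derive s 1
      (fun s : R => f (x + tr k + s *: delta_mx 0 k) 0 j) (dk s).
    move=> /tr_le/dP[fdk _]; rewrite addrA in fdk.
    exact: is_derive_entry (is_derive_line (fdk k)).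
  have [c ch] := mvt0 dF.
  rewrite scale0r addr0 -addrA -trS -/(F _) -/(F _) => ->.
  rewrite [dk c * _]mulrC -mulrBr normrM mulrC ler_pM// ?entry_le_mxnorm//.
  have [_ /(_ k)] := dP _ (tr_le _ _ ch).
  rewrite addrA => /(le_trans _); apply.
  by apply: le_trans (entry_le_mxnorm _ 0 j); rewrite !mxE.
have -> : (f (h + x) - f x - h *m B) 0 j =
    \sum_(k < m) (F k.+1 - F k - h 0 k * B k j).
  rewrite sumrB -(big_mkord xpredT (fun k => F k.+1 - F k)) telescope_sumr//.
  by rewrite /F tr0 trm addr0 addrC !mxE [h + x]addrC addrC.
apply: le_trans (ler_norm_sum _ _ _) _.
apply: le_trans (ler_sum _ (fun k _ => step k)) _.
rewrite sumr_const card_ord -[_ *+ _]mulr_natl mulrA ler_wpM2r//.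
by rewrite mulrCA ler_piMr ?(ltW e0)// ler_pdivrMr// mul1r ler_nat.
Unshelve. all: by end_near. Qed.
End Frechet.

(** * Iterated partial and directional derivatives *)

Section DeriveSum.
Variables (R : realType) (V W : normedModType R).

Lemma is_derive_bigsum n (h : 'I_n -> V -> W) (dh : 'I_n -> W) (x v : V) :
  (forall i, is_derive x v (h i) (dh i)) ->
  is_derive x v (fun y => \sum_i h i y) (\sum_i dh i).
Proof.
move=> hd; have -> : (fun y => \sum_i h i y) = \sum_i h i.
  by apply/funext => y; rewrite fct_sumE.
exact: is_derive_sum.
Qed.

Lemma differentiable_bigsum n (h : 'I_n -> V -> W) (x : V) :
  (forall i, differentiable (h i) x) ->
  differentiable (fun y => \sum_i h i y) x.
Proof.
move=> hd; have -> : (fun y => \sum_i h i y) = \sum_i h i.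
  by apply/funext => y; rewrite fct_sumE.
exact: differentiable_sum.
Qed.

End DeriveSum.

Lemma is_derive_mull (R : realType) (V : normedModType R) (f : V -> R)
    (k df : R) (x v : V) :
  is_derive x v f df -> is_derive x v (fun y => k * f y) (k * df).
Proof. exact: (@is_deriveZ R V R^o f k x v df). Qed.

Section Pderiv.
Variables (R : realType) (m n : nat).
Implicit Types (f g : 'rV[R]_m -> 'rV[R]_n) (A : set 'rV[R]_m).

Lemma near_open A x : open A -> A x -> \forall y \near x, A y.
Proof. by move=> Ao Ax; apply: open_nbhs_nbhs. Qed.

Lemma Ck_on_differentiable k A f s x : open A -> Ck_on k A f ->
  (size s < k)%N -> A x -> differentiable (pderiv s f) x.
Proof.
move=> Ao [fd fc] sk Ax; apply: continuous_partials_differentiable.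
  by apply: filterS (near_open Ao Ax) => y Ay i; exact: fd.
by move=> i; apply: (fc (i :: s)).
Qed.

End Pderiv.

(** * Differentiating an inverse matrix *)

Section Cofinv.
Variables (R : realType).

(** Cramer's form of the inverse, given by one formula in the entries, whereas
    [invmx] is defined by cases on invertibility. *)
Definition cofinv n (A : 'M[R]_n) : 'M[R]_n := (\det A)^-1 *: \adj A.

Lemma cofinvE n (A : 'M[R]_n) : A \in unitmx -> cofinv A = invmx A.
Proof. by move=> Au; rewrite /invmx Au. Qed.

Variable V : normedModType R.

Lemma differentiable_bigprod n (h : 'I_n -> V -> R) (x : V) :
  (forall i, differentiable (h i) x) ->
  differentiable (fun y => \prod_i h i y) x.
Proof.
elim: n h => [|n IH] h hd.
  have -> : (fun y => \prod_(i < 0) h i y) = cst 1.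
    by apply/funext => y; rewrite big_ord0.
  exact: differentiable_cst.
have -> : (fun y => \prod_(i < n.+1) h i y) =
    h ord0 * (fun y => \prod_(i < n) h (lift ord0 i) y).
  by apply/funext => y; rewrite big_ord_recl.
by apply: differentiableM => //; exact: IH.
Qed.

Lemma differentiable_fin (W : normedModType R) (I : finType) (h : I -> V -> W)
    (x : V) :
  (forall i, differentiable (h i) x) ->
  differentiable (fun y => \sum_i h i y) x.
Proof.
move=> hd; have -> : (fun y => \sum_i h i y) =
    (fun y => \sum_(j < #|I|) h (enum_val j) y).
  by apply/funext => y; rewrite -(big_enum_val (A := I) (fun i => h i y)).
exact: differentiable_bigsum.
Qed.

Lemma is_derive_fin (W : normedModType R) (I : finType) (h : I -> V -> W)
    (dh : I -> W) (x v : V) :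
  (forall i, is_derive x v (h i) (dh i)) ->
  is_derive x v (fun y => \sum_i h i y) (\sum_i dh i).
Proof.
move=> hd; have -> : (fun y => \sum_i h i y) =
    (fun y => \sum_(j < #|I|) h (enum_val j) y).
  by apply/funext => y; rewrite -(big_enum_val (A := I) (fun i => h i y)).
rewrite (big_enum_val (A := I) dh); exact: is_derive_bigsum.
Qed.

Lemma differentiable_mull (k : R) (f : V -> R) (x : V) :
  differentiable f x -> differentiable (fun y => k * f y) x.
Proof. exact: (@differentiableZ R V R^o f k x). Qed.

Lemma differentiable_det n (A : V -> 'M[R]_n) (x : V) :
  (forall i j, differentiable (fun y => A y i j) x) ->
  differentiable (fun y => \det (A y)) x.
Proof.
move=> Ad; rewrite /determinant; apply: differentiable_fin => s.
by apply: differentiable_mull; exact: differentiable_bigprod.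
Qed.

Lemma differentiable_cofinv n (A : V -> 'M[R]_n) (x : V) i j :
  (forall i j, differentiable (fun y => A y i j) x) -> A x \in unitmx ->
  differentiable (fun y => cofinv (A y) i j) x.
Proof.
move=> Ad Au.
have -> : (fun y => cofinv (A y) i j) =
    (fun y => (\det (A y))^-1) * (fun y => cofactor (A y) j i).
  by apply/funext => y; rewrite !mxE.
apply: differentiableM.
  apply: differentiableV; first exact: differentiable_det.
  by rewrite -unitfE -unitmxE.
apply: differentiable_mull; apply: differentiable_det => k l.
have -> : (fun y => row' j (col' i (A y)) k l) =
  (fun y => A y (lift j k) (lift i l)) by apply/funext => y; rewrite !mxE.
exact: Ad.
Qed.

(** Differentiate [A A^-1 = 1]. *)
Lemma is_derive_cofinv n (A : V -> 'M[R]_n) (dA : 'M[R]_n) (x v : V) i j :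
  (forall i j, differentiable (fun y => A y i j) x) ->
  (\forall y \near x, A y \in unitmx) ->
  (forall i j, is_derive x v (fun y => A y i j) (dA i j)) ->
  is_derive x v (fun y => cofinv (A y) i j)
    (- (cofinv (A x) *m dA *m cofinv (A x)) i j).
Proof.
move=> Ad Au AdA; have Aux := nbhs_singleton Au.
pose dY := \matrix_(i, j) 'D_v (fun y => cofinv (A y) i j) x.
have YdY k l : is_derive x v (fun y => cofinv (A y) k l) (dY k l).
  rewrite mxE; apply: DeriveDef => //; apply: diff_derivable.
  exact: differentiable_cofinv.
have AY k l : \sum_p (A x k p * dY p l + cofinv (A x) p l * dA k p) = 0.
  have d1 : is_derive x v (fun y => \sum_p A y k p * cofinv (A y) p l)
      (\sum_p (A x k p * dY p l + cofinv (A x) p l * dA k p)).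
    by apply: is_derive_bigsum => p; apply: is_deriveM.
  have d0 : is_derive x v (fun y => \sum_p A y k p * cofinv (A y) p l) 0.
    apply: (@near_eq_is_derive _ _ _ (cst ((1%:M : 'M[R]_n) k l))).
    by apply: filterS Au => y Ay; rewrite -(mulmxV Ay) -cofinvE// mxE.
  have [_ E1] := d1; have [_ E0] := d0; by rewrite -E1 E0.
have {}AY : A x *m dY = - (dA *m cofinv (A x)).
  apply/matrixP => k l; apply/eqP; rewrite -subr_eq0 -[X in _ == X](AY k l).
  rewrite !mxE opprK -big_split/=; apply/eqP; apply: eq_bigr => p _.
  by rewrite [dA _ _ * _]mulrC.
have -> : - (cofinv (A x) *m dA *m cofinv (A x)) i j = dY i j; last exact: YdY.
have -> : dY = - (cofinv (A x) *m dA *m cofinv (A x)).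
  by rewrite -mulmxA -mulmxN -AY mulmxA cofinvE// mulVmx// mul1mx.
by rewrite [RHS]mxE.
Qed.

End Cofinv.

(** * Continuity, directional derivatives and Taylor's formula *)

Lemma continuous_coord (R : realType) (T : topologicalType) n
    (f : T -> 'rV[R]_n) (x : T) (i : 'I_n) :
  {for x, continuous f} -> {for x, continuous (fun y => f y 0 i)}.
Proof.
move=> fc; apply: (@continuous_comp _ _ _ f (fun M : 'rV[R]_n => M 0 i)) => //.
exact: coord_continuous.
Qed.

Lemma continuous_mull (R : realType) (T : topologicalType) (k : R)
    (f : T -> R) (x : T) :
  {for x, continuous f} -> {for x, continuous (fun y => k * f y)}.
Proof.
by move=> fc; apply: (@continuousM _ _ (cst k) f) => //; exact: cst_continuous.
Qed.

Lemma continuous_bigsum (R : realType) (T : topologicalType) n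
    (h : 'I_n -> T -> R) (x : T) :
  (forall i, {for x, continuous (h i)}) ->
  {for x, continuous (fun y => \sum_i h i y)}.
Proof.
elim: n h => [|n IH] h hc.
  have -> : (fun y => \sum_(i < 0) h i y) = cst 0.
    by apply/funext => y; rewrite big_ord0.
  exact: cvg_cst.
have -> : (fun y => \sum_(i < n.+1) h i y) =
    h ord0 \+ (fun y => \sum_(i < n) h (lift ord0 i) y).
  by apply/funext => y; rewrite big_ord_recl.
by apply: continuousD => //; exact: IH.
Qed.

Lemma sum_exchange_mul (R : comPzRingType) (I J : finType) (c : R)
    (a : J -> R) (x : I -> R) (q : I -> J -> R) :
  c * (\sum_i x i * \sum_j a j * q i j) =
  \sum_j a j * (c * \sum_i x i * q i j).
Proof.
under eq_bigr do rewrite mulr_sumr.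
rewrite exchange_big mulr_sumr; apply: eq_bigr => j _.
rewrite mulrCA; congr (_ * _); rewrite mulr_sumr.
by apply: eq_bigr => n _; rewrite mulrCA.
Qed.

Lemma is_derive_row (R : realType) (V : normedModType R) n
    (f : 'I_n -> V -> R) (df : 'I_n -> R) (x v : V) :
  (forall i, is_derive x v (f i) (df i)) ->
  is_derive x v (fun y => \row_i f i y) (\row_i df i).
Proof.
move=> fd; have rd : derivable (fun y => \row_i f i y) x v.
  apply/derivable_mxP => r i.
  have -> : (fun y => (\row_i f i y) r i) = f i.
    by apply/funext => y; rewrite mxE.
  by have [] := fd i.
apply: DeriveDef => //; rewrite derive_mx//; apply/rowP => i; rewrite !mxE.
have -> : (fun y => (\row_i f i y) 0 i) = f i by apply/funext => y; rewrite mxE.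
by have [] := fd i.
Qed.

Lemma continuous_row (R : realType) (V : normedModType R) n
    (f : 'I_n -> V -> R) (x : V) :
  (forall i, {for x, continuous (f i)}) ->
  {for x, continuous (fun y => \row_i f i y)}.
Proof.
move=> fc; apply/(@cvgrPdist_le _ _ _ (nbhs x)) => e e0.
have fe i : \forall y \near x, `|f i x - f i y| <= e.
  by have /cvgrPdist_le/(_ _ e0) := fc i.
apply: filterS (filter_forall _ fe) => y xy.
by apply: mxnorm_le => [|r i]; [exact: ltW|rewrite !mxE; exact: xy].
Qed.

Lemma near_eq_continuous (R : realType) (V W : normedModType R) (f g : V -> W)
    (x : V) : (\forall y \near x, f y = g y) ->
  {for x, continuous f} -> {for x, continuous g}.
Proof.
move=> fg fc; have fgx : f x = g x := nbhs_singleton fg.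
rewrite /prop_for /continuous_at -fgx.
by apply: cvg_trans fc; apply: near_eq_cvg; apply: filterS fg => y ->.
Qed.

Section Dirderiv.
Variables (R : realType) (m n : nat).
Implicit Types (f : 'rV[R]_m -> 'rV[R]_n) (u v : 'rV[R]_m).

Lemma dirderiv0 v f : dirderiv 0 v f = f.
Proof.
apply/funext => u; rewrite /dirderiv (big_pred1 [tuple]) => [|s].
  by rewrite big_nil scale1r.
  by rewrite [s]tuple0; apply/esym/eqP.
Qed.

Lemma dirderivZ k (a : R) v f u :
  dirderiv k (a *: v) f u = a ^+ k *: dirderiv k v f u.
Proof.
rewrite /dirderiv scaler_sumr; apply: eq_bigr => s _; rewrite scalerA.
under eq_bigr do rewrite mxE; rewrite big_split/=; congr (_ * _ *: _).
by rewrite big_const_seq count_predT size_tuple iter_mulr_1.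
Qed.

Lemma dirderiv_differentiable K k A f v u : open A -> Ck_on K A f ->
  (k < K)%N -> A u -> differentiable (dirderiv k v f) u.
Proof.
move=> Ao fK kK Au; apply: differentiable_fin => s.
apply: (@differentiableZ _ _ _ (pderiv s f)).
by apply: Ck_on_differentiable Ao fK _ Au; rewrite size_tuple.
Qed.

(** A tuple of length [k + 1] is split into its head, which indexes the
    outermost derivative, and its tail. *)
Lemma dirderivS K k A f v u : open A -> Ck_on K A f -> (k < K)%N -> A u ->
  dirderiv k.+1 v f u = 'D_v (dirderiv k v f) u.
Proof.
move=> Ao fK kK Au.
have sd (s : k.-tuple 'I_m) : differentiable (pderiv s f) u.
  by apply: Ck_on_differentiable Ao fK _ Au; rewrite size_tuple.
have : is_derive u v (dirderiv k v f)
    (\sum_(s : k.-tuple 'I_m) (\prod_(i <- s) v 0 i) *: 'D_v (pderiv s f) u).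
  apply: is_derive_fin => s; apply: (@is_deriveZ _ _ _ (pderiv s f)).
  by apply: DeriveDef => //; exact: diff_derivable.
case=> _ ->.
rewrite /dirderiv.
rewrite (reindex (fun p : 'I_m * k.-tuple 'I_m => [tuple of p.1 :: p.2]))/=.
  rewrite -(pair_bigA _ (fun i (s : k.-tuple 'I_m) =>
    (\prod_(l <- i :: s) v 0 l) *: 'D_(delta_mx 0 i) (pderiv s f) u))/=.
  rewrite exchange_big; apply: eq_bigr => s _.
  rewrite deriveE// diffE_row// scaler_sumr; apply: eq_bigr => i _.
  by rewrite big_cons scalerA mulrC.
exists (fun s : k.+1.-tuple 'I_m => (thead s, [tuple of behead s])).
  by move=> [i s] _; congr pair; apply/val_inj.
by move=> s _; case/tupleP: s => i s; apply/val_inj.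
Qed.

End Dirderiv.

(** Taylor's formula with a crude constant: the remainder of order [k] is an
    antiderivative, vanishing at [0], of the remainder of order [k - 1] of the
    derivative. *)
Lemma taylor_bound (R : realType) k (f : nat -> R -> R) (B : R) :
  (forall j (t : R), (j < k)%N -> 0 <= t <= 1 ->
     is_derive t 1 (f j) (f j.+1 t)) ->
  (forall t : R, 0 <= t <= 1 -> `|f k t| <= B) ->
  forall t : R, 0 <= t <= 1 ->
    `|f 0%N t - \sum_(j < k) j`!%:R^-1 * t ^+ j * f j 0| <= B.
Proof.
elim: k f => [|k IH] f fd fB t t01; first by rewrite big_ord0 subr0 fB.
pose r (t : R) := f 0%N t - \sum_(j < k.+1) j`!%:R^-1 * t ^+ j * f j 0.
pose dr (t : R) := f 1%N t - \sum_(j < k) j`!%:R^-1 * t ^+ j * f j.+1 0.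
have drB (s : R) : 0 <= s <= 1 -> `|dr s| <= B.
  by apply: (IH (fun j => f j.+1)) => // j s' jk; exact: fd.
have rd (s : R) : 0 <= s <= 1 -> is_derive s 1 r (dr s).
  move=> s01; have -> : r = f 0%N - (cst (f 0%N 0) +
      (fun t => \sum_(j < k) f j.+1 0 * (j.+1`!%:R^-1 * t ^+ j.+1))).
    apply/funext => x; rewrite /r big_ord_recl /= !fctE.
    rewrite fact0 invr1 expr0 !mul1r; congr (_ - (_ + _)).
    by apply: eq_bigr => j _; rewrite mulrC.
  have d j : is_derive s 1 (fun t : R => f j.+1 0 * (j.+1`!%:R^-1 * t ^+ j.+1))
      (f j.+1 0 * (j`!%:R^-1 * s ^+ j)).
    apply: is_derive_mull.
    have dX : is_derive s 1 (fun t : R => t ^+ j.+1) (j.+1%:R * s ^+ j).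
      apply: DeriveDef; first exact: exprn_derivable.
      by rewrite exp_derive /= [_ *: 1]mulr1.
    have -> : j`!%:R^-1 * s ^+ j = j.+1`!%:R^-1 * (j.+1%:R * s ^+ j).
      rewrite mulrA; congr (_ * _); rewrite factS natrM invfM mulrAC.
      by rewrite mulVf ?mul1r// pnatr_eq0.
    exact: is_derive_mull.
  apply: is_derive_eq (is_deriveB (fd 0%N s isT s01)
    (is_deriveD (is_derive_cst (f 0%N 0) s 1)
      (is_derive_bigsum (fun j : 'I_k => d j)))) _.
  rewrite add0r /dr; congr (_ - _).
  by apply: eq_bigr => j _; rewrite mulrC.
have t0 : 0 <= t by case/andP: t01.
have rd' (s : R) : 0 <= s <= t -> is_derive s 1 r (dr s).
  move=> /andP[s0 st]; apply: rd; rewrite s0 (le_trans st)//.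
  by case/andP: t01.
have [c /andP[c0 ct]] := mvt_segment t0 rd'.
have -> : r 0 = 0.
  rewrite /r big_ord_recl /= fact0 invr1 expr0 !mul1r big1 ?addr0 ?subrr//.
  by move=> j _; rewrite expr0n mulr0 mul0r.
rewrite subr0 -/(r t) => ->; rewrite normrM.
have t1 : t <= 1 by case/andP: t01.
have B0 : 0 <= B by apply: le_trans (drB t t01).
rewrite -[leRHS]mulr1; apply: ler_pM => //; last by rewrite ger0_norm ?subr0.
by apply: drB; rewrite c0 (le_trans ct).
Qed.

(** * Formal derivatives of the root map *)

Section Expr.
Variables (D : nat) (V : Type).

(** The quantities, evaluated at the root [theta u], from which the derivatives
    of [theta] are built: [Val s i] stands for the partial derivative of index
    [s] of the [i]-th component of [G_u], [Dir v s i] for the same with [G_u]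
    replaced by [1 / N * sum_n v_n g_n], the variation of [G_u] in the
    direction [v], and [HInv i j] for an entry of the inverse of the Jacobian.
    The type [V] only names directions: instances with different [N] share the
    same expressions. *)
Inductive expr : Type :=
| Val of seq 'I_D & 'I_D
| Dir of V & seq 'I_D & 'I_D
| HInv of 'I_D & 'I_D
| Neg of expr
| Add of expr & expr
| Mul of expr & expr
| Sum of ('I_D -> expr).

(** First derivative of the root: [- H^-1 * (variation of G in direction v)]. *)
Definition droot (v : V) (i : 'I_D) : expr :=
  Neg (Sum (fun j => Mul (HInv i j) (Dir v [::] j))).

(** A partial derivative of [G_u] at [theta u] varies with the root and
    with [u]. *)
Definition dval (v : V) (s : seq 'I_D) (i : 'I_D) : expr :=
  Add (Sum (fun j => Mul (droot v j) (Val (j :: s) i))) (Dir v s i).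

Fixpoint dexpr (v : V) (e : expr) : expr :=
  match e with
  | Val s i => dval v s i
  | Dir w s i => Sum (fun j => Mul (droot v j) (Dir w (j :: s) i))
  | HInv i j => Neg (Sum (fun l => Mul (Sum (fun k =>
      Mul (HInv i k) (dval v [:: l] k))) (HInv l j)))
  | Neg e => Neg (dexpr v e)
  | Add e1 e2 => Add (dexpr v e1) (dexpr v e2)
  | Mul e1 e2 => Add (Mul e1 (dexpr v e2)) (Mul e2 (dexpr v e1))
  | Sum f => Sum (fun j => dexpr v (f j))
  end.

(** The order counts derivatives of the [g_n], so that it decides which
    expressions may still be differentiated. [Val] requires [1 <= size s]
    because the bounds [M] concern the derivatives of [G], not [G] itself;
    [HInv] involves first derivatives. *)
Fixpoint has_order (m : nat) (e : expr) : Prop :=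
  match e with
  | Val s _ => (1 <= size s <= m)%N
  | Dir _ s _ => (size s <= m)%N
  | HInv _ _ => (1 <= m)%N
  | Neg e => has_order m e
  | Add e1 e2 | Mul e1 e2 => has_order m e1 /\ has_order m e2
  | Sum f => forall j, has_order m (f j)
  end.

Lemma has_orderW m m' e : (m <= m')%N -> has_order m e -> has_order m' e.
Proof.
move=> mm'; elim: e => //=.
- by move=> s _ /andP[-> /leq_trans]; apply.
- by move=> _ s _ /leq_trans; apply.
- by move=> _ _ /leq_trans; apply.
- by move=> e1 IH1 e2 IH2 [/IH1 ? /IH2].
- by move=> e1 IH1 e2 IH2 [/IH1 ? /IH2].
- by move=> f IH fm j; exact: IH.
Qed.

Lemma has_order_dexpr v m e : has_order m e -> has_order m.+1 (dexpr v e).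
Proof.
elim: e => //=.
- by move=> s i /andP[s0 sm]; do !split => //; rewrite ltnW.
- by move=> e1 IH1 e2 IH2 [/IH1 ? /IH2].
- move=> e1 IH1 e2 IH2 [m1 m2]; do !split; do ?[exact: IH1|exact: IH2].
  + exact: has_orderW m1.
  + exact: has_orderW m2.
- by move=> f IH fm j; exact: IH.
Qed.

Fixpoint droots (v : V) (s : seq V) (i : 'I_D) : expr :=
  if s is w :: s' then dexpr v (droots w s' i) else droot v i.

Lemma has_order_droots v s i : has_order (size s).+1 (droots v s i).
Proof.
by elim: s v => [//|w s IH] v; exact: has_order_dexpr.
Qed.

End Expr.

(** A bound of an expression, valid when [delta <= 1] and the directional atoms
    are at most [1]; [c] is the coercivity constant of the Jacobian. *)
Fixpoint ebound (R : realType) (D : nat) (V : Type) (M : nat -> R) (c : R)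
    (e : expr D V) : R :=
  match e with
  | Val s _ => M (size s) + 1
  | Dir _ _ _ => 1
  | HInv _ _ => c^-1
  | Neg e => ebound M c e
  | Add e1 e2 => ebound M c e1 + ebound M c e2
  | Mul e1 e2 => ebound M c e1 * ebound M c e2
  | Sum f => \sum_j ebound M c (f j)
  end.

(** * Strong monotonicity on an instance *)

Section Instance.
Variables (R : realType) (D kIJ : nat) (Cop rho : R) (M : nat -> R).
Variable X : instance R D.
Hypothesis Cop0 : 0 < Cop.
Hypothesis rho01 : 0 < rho < 1.
Hypothesis kIJ1 : (1 <= kIJ)%N.
Hypothesis M0 : forall k, (1 <= k <= kIJ.+1)%N -> 0 <= M k.
Hypothesis admX : admissible X kIJ Cop rho M.

Local Notation N := (nobs X).
Local Notation Ot := (Omega_theta X).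
Local Notation Ow := (Omega_w X).
Local Notation theta := (theta_hat X).
Local Notation hull := (convex_hull [set theta u | u in Ow]).

Let N0 : N%:R != 0 :> R.
Proof. by rewrite pnatr_eq0 -lt0n (adm_N admX). Qed.

Lemma hull_sub th : hull th -> Ot th.
Proof.
move=> hth; have [e e0 eP] := adm_hull admX.
by apply: (eP th th) => //; rewrite subrr enorm0.
Qed.

Lemma hull_segment a b (t : R) : hull a -> hull b -> 0 <= t <= 1 ->
  hull (b + t *: (a - b)).
Proof.
move=> ha hb /andP[t0 t1] A [Ac AX].
have := Ac a b (Itv01 t0 t1); rewrite !inE.
move=> /(_ (ha A (conj Ac AX)) (hb A (conj Ac AX))).
have -> : @conv R (convex_lmodType 'rV[R]_D) (Itv01 t0 t1) a b =
    b + t *: (a - b).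
  have -> : b + t *: (a - b) = t *: a + (1 - t) *: b; last by [].
  by rewrite scalerBl scale1r scalerBr addrCA.
by [].
Qed.

Lemma theta_hull u : Ow u -> hull (theta u).
Proof. by move=> uO; apply: sub_gen_smallest; exists u. Qed.

Lemma theta_root_in u : Ow u -> Ot (theta u).
Proof. by move=> Ou; exact: hull_sub (theta_hull Ou). Qed.

Lemma Ow_open : open Ow.
Proof.
rewrite openE => u [t [t01 ut]].
set z := (1 - t) *: ones X + t *: wgt X in ut.
have N1 : 0 < N%:R + 1 :> R by rewrite ltr_wpDl.
have d0 : 0 < (eps X - enorm (u - z)) / (N%:R + 1).
  by rewrite divr_gt0 ?subr_gt0.
suff : \forall y \near u, Ow y by [].
apply/near_normP; exists ((eps X - enorm (u - z)) / (N%:R + 1)) => // y.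
rewrite ltr_pdivlMr// => yu.
exists t; split=> //.
have -> : y - z = (u - z) + (y - u) by rewrite [RHS]addrC addrA subrK.
apply: le_lt_trans (enormD _ _) _; rewrite -ltrBrDl; apply: le_lt_trans yu.
apply: le_trans (enorm_le_mxnorm _) _.
by rewrite mul1n mulrC ler_wpM2l// lerDl.
Qed.

Lemma Ow_segment (t : R) : 0 <= t <= 1 -> Ow (ones X + t *: Delta_w X).
Proof.
move=> t01; exists t; split=> //.
have -> : ones X + t *: Delta_w X = (1 - t) *: ones X + t *: wgt X.
  by rewrite /Delta_w scalerBr scalerBl scale1r addrCA addrC.
by rewrite subrr enorm0 (adm_eps admX).
Qed.

Lemma Ow_wgt : Ow (wgt X).
Proof.
have := @Ow_segment 1; rewrite scale1r /Delta_w addrC subrK; apply.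
by rewrite lexx ler01.
Qed.

(** [Gpart s th u] is the partial derivative of [G_u] of index [s], written so
    that it is affine in [u] even where the partial derivatives do not exist;
    [Gdir s th v] is its linear part. *)
Definition Gpart (s : seq 'I_D) (th : 'rV[R]_D) (u : 'rV[R]_N) : 'rV[R]_D :=
  N%:R^-1 *: (pderiv s (gfun X ord0) th +
              \sum_(n < N) u 0 n *: pderiv s (gfun X (lift ord0 n)) th).

Definition Gdir (s : seq 'I_D) (th : 'rV[R]_D) (v : 'rV[R]_N) : 'rV[R]_D :=
  N%:R^-1 *: \sum_(n < N) v 0 n *: pderiv s (gfun X (lift ord0 n)) th.

Lemma GpartD s th u v : Gpart s th (u + v) = Gpart s th u + Gdir s th v.
Proof.
rewrite /Gpart /Gdir -scalerDr -addrA -big_split/=.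
by under eq_bigr do rewrite mxE scalerDl.
Qed.

Lemma GdirE s th v : Gdir s th v =
  v *m (N%:R^-1 *: \matrix_n pderiv s (gfun X (lift ord0 n)) th).
Proof.
rewrite -scalemxAr mulmx_sum_row /Gdir; congr (_ *: _).
by apply: eq_bigr => n _; rewrite rowK.
Qed.

Lemma g_differentiable n s th : (size s <= kIJ)%N -> Ot th ->
  differentiable (pderiv s (gfun X n)) th.
Proof.
by move=> sk; apply: Ck_on_differentiable (adm_open admX) (adm_smooth admX n) _.
Qed.

Lemma Gpart_differentiable s u th : (size s <= kIJ)%N -> Ot th ->
  differentiable (Gpart s ^~ u) th.
Proof.
move=> sk Oth.
have -> : Gpart s ^~ u = N%:R^-1 *: (pderiv s (gfun X ord0) +
  (fun th => \sum_(n < N) u 0 n *: pderiv s (gfun X (lift ord0 n)) th)) by [].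
apply: differentiableZ; apply: differentiableD; first exact: g_differentiable.
apply: differentiable_bigsum => n.
have -> : (fun th => u 0 n *: pderiv s (gfun X (lift ord0 n)) th) =
  u 0 n *: pderiv s (gfun X (lift ord0 n)) by [].
by apply: differentiableZ; exact: g_differentiable.
Qed.

Lemma Gpart_derive s u th j : (size s <= kIJ)%N -> Ot th ->
  'D_(delta_mx 0 j) (Gpart s ^~ u) th = Gpart (j :: s) th u.
Proof.
move=> sk Oth.
have gd n : is_derive th (delta_mx 0 j) (pderiv s (gfun X n))
    (pderiv (j :: s) (gfun X n) th).
  by apply: DeriveDef => //; apply: diff_derivable; exact: g_differentiable.
have : is_derive th (delta_mx 0 j) (Gpart s ^~ u) (Gpart (j :: s) th u).
  have -> : Gpart s ^~ u = N%:R^-1 *: (pderiv s (gfun X ord0) +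
    (fun th => \sum_(n < N) u 0 n *: pderiv s (gfun X (lift ord0 n)) th)) by [].
  apply: is_deriveZ; apply: is_deriveD.
  by apply: is_derive_bigsum => n; apply: is_deriveZ.
by case.
Qed.

Lemma pderiv_G s u th : (size s <= kIJ.+1)%N -> Ot th ->
  pderiv s (G X ^~ u) th = Gpart s th u.
Proof.
elim: s th => [//|j s IH] th sk Oth /=.
rewrite -Gpart_derive//; apply: near_eq_derive.
by apply: filterS (near_open (adm_open admX) Oth) => y; apply: IH; exact: ltnW.
Qed.

Lemma dG_entry s u th i : (size s <= kIJ.+1)%N -> Ot th ->
  dG X (size s) th u (in_tuple s, i) = Gpart s th u 0 i.
Proof. by move=> sk Oth; rewrite ffunE pderiv_G. Qed.

Lemma dG_delta k u th : (k <= kIJ.+1)%N -> Ow u -> Ot th ->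
  l2norm (dG X k th u - dG X k th (ones X)) <= delta_ X k.
Proof.
move=> kk Ou Oth; rewrite -lee_fin; apply: le_trans (adm_delta admX kk).
apply: (@le_trans _ _ (ereal_sup
  [set (l2norm (dG X k th u - dG X k th (ones X)))%:E | th in Ot])).
  by apply: ereal_sup_ubound; exists th.
by apply: ereal_sup_ubound; exists u.
Qed.

Lemma Gpart_delta s u th i : (size s <= kIJ.+1)%N -> Ow u -> Ot th ->
  `|(Gpart s th u - Gpart s th (ones X)) 0 i| <= delta_ X (size s).
Proof.
move=> sk Ou Oth; apply: le_trans (dG_delta sk Ou Oth).
apply: le_trans (normr_le_l2norm _ (in_tuple s, i)).
by rewrite !ffunE /= !pderiv_G// !mxE.
Qed.

Lemma Gpart_bound s u th i : (1 <= size s <= kIJ.+1)%N -> Ow u -> Ot th ->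
  `|Gpart s th u 0 i| <= M (size s) + delta_ X (size s).
Proof.
move=> /[dup] sk1 /andP[_ sk] Ou Oth.
have -> : Gpart s th u 0 i =
    Gpart s th (ones X) 0 i + (Gpart s th u - Gpart s th (ones X)) 0 i.
  by rewrite !mxE addrCA subrr addr0.
apply: le_trans (ler_normD _ _) _; apply: lerD; last exact: Gpart_delta.
rewrite -dG_entry//; apply: le_trans (normr_le_l2norm _ _) _.
rewrite -lee_fin; apply: le_trans (adm_M admX sk1).
by apply: ereal_sup_ubound; exists th.
Qed.

(** By affinity [Gdir s th Delta] is the difference of the derivatives at the
    weights [w] and [1]; the supremum bounded by [delta_] runs over [Omega_w],
    which contains [w]. *)
Lemma Gdir_bound s th i : (size s <= kIJ.+1)%N -> Ot th ->
  `|Gdir s th (Delta_w X) 0 i| <= delta_ X (size s).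
Proof.
move=> sk Oth.
have -> : Gdir s th (Delta_w X) = Gpart s th (wgt X) - Gpart s th (ones X).
  have -> : wgt X = ones X + Delta_w X by rewrite /Delta_w addrC subrK.
  by rewrite GpartD addrC addKr.
exact: Gpart_delta Ow_wgt Oth.
Qed.

Lemma HE u th i j : Ot th -> H X th u i j = Gpart [:: j] th u 0 i.
Proof. by move=> Oth; rewrite mxE pderiv_G. Qed.

(** The common lower bound of the Jacobians as quadratic forms. *)
Definition mono_const : R := (1 - rho) / Cop.

Lemma mono_const_gt0 : 0 < mono_const.
Proof. by case/andP: rho01 => _ r1; rewrite divr_gt0// subr_gt0. Qed.

(** The term [Cop^2 M_2 delta_0] of [adm_rho] is nonnegative, so
    [Cop delta_1 <= rho], and [1 / Cop - delta_1] is at least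
    [(1 - rho) / Cop]. *)
Lemma H_coercive u th : Ow u -> Ot th -> coercive mono_const (H X th u).
Proof.
move=> Ou Oth.
have cH1 : coercive Cop^-1 (H X th (ones X)).
  apply: posdef_coercive => //; first exact: (adm_posdef admX).
  rewrite -lee_fin; apply: le_trans (adm_Cop admX).
  by apply: ereal_sup_ubound; exists th.
have HH : enorm (H X th u - H X th (ones X)) <= delta_ X 1%N.
  apply: le_trans (dG_delta (k := 1) _ Ou Oth) => //.
  rewrite /enorm /l2norm le_eqVlt; apply/orP; left; apply/eqP; congr Num.sqrt.
  rewrite (reindex (fun p : 1.-tuple 'I_D * 'I_D => (p.2, thead p.1)))/=.
    apply: eq_bigr => -[s i] _ /=; rewrite !ffunE /= !mxE.
    by case/tupleP: s => j s; rewrite (tuple0 s) theadE.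
  exists (fun p => ([tuple p.2], p.1)) => -[s i] _ //=.
  by case/tupleP: s => j s; rewrite (tuple0 s) theadE.
have := coercive_perturb cH1 HH => cHu x; apply: le_trans (cHu x).
apply: ler_wpM2r; first exact: sqr_ge0.
have := adm_rho admX.
have M2 : 0 <= M 2 by apply: M0; rewrite /= ltnS.
have : 0 <= Cop ^+ 2 * M 2 * delta_ X 0%N.
  apply: mulr_ge0; last exact: (adm_delta_ge0 admX).
  by apply: mulr_ge0 => //; exact: sqr_ge0.
move=> h1 h2; rewrite /mono_const mulrBl mul1r lerD2l lerN2 ler_pdivlMr//.
rewrite mulrC; lra.
Qed.

(** The mean value theorem along the segment from [b] to [a] turns the
    coercivity of the Jacobian into strong monotonicity. *)
Lemma G_monotone u a b : Ow u -> hull a -> hull b ->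
  mono_const * enorm (a - b) ^+ 2 <= ((a - b) *m (G X a u - G X b u)^T) 0 0.
Proof.
move=> Ou ha hb; set v := a - b.
pose f (t : R) := \sum_i v 0 i * G X (b + t *: v) u 0 i.
pose df (t : R) := (v *m H X (b + t *: v) u *m v^T) 0 0.
have fdf (t : R) : 0 <= t <= 1 -> is_derive t 1 f (df t).
  move=> t01; have Ot_t := hull_sub (hull_segment ha hb t01).
  have Gd : differentiable (G X ^~ u) (b + t *: v).
    exact: (@Gpart_differentiable [::]).
  have -> : df t = \sum_i v 0 i * ('D_v (G X ^~ u) (b + t *: v)) 0 i.
    rewrite /df -mulmxA mxE; apply: eq_bigr => i _; congr (_ * _).
    rewrite deriveE// diffE_row// summxE mxE; apply: eq_bigr => j _.
    by rewrite HE// [v^T j 0]mxE -(@Gpart_derive [::])// [RHS]mxE mulrC.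
  apply: is_derive_bigsum => i; apply: is_derive_mull.
  apply: is_derive_entry; apply: (is_derive_line (f := G X ^~ u)).
  exact: diff_derivable.
have [c c01] := mvt_segment ler01 fdf.
rewrite subr0 mulr1 /f scale0r scale1r addr0 /v [b + _]addrC subrK -/v => E.
have -> : (v *m (G X a u - G X b u)^T) 0 0 = df c.
  rewrite -E mxE -sumrB; apply: eq_bigr => i _.
  by rewrite -mulrBr; congr (_ * _); rewrite !mxE.
have := H_coercive Ou (hull_sub (hull_segment ha hb c01)) v^T.
by rewrite trmxK enorm_trmx.
Qed.

(** Strong monotonicity of [G_u'] between the roots for [u'] and [u]: there
    [G_u'] takes the values [0] and the variation of [G] in the direction
    [u' - u], which is linear in [u' - u]. *)
Lemma theta_lipschitz u : Ow u -> exists2 K : R, 0 <= K &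
  forall u', Ow u' -> `|theta u' - theta u| <= K * `|u' - u|.
Proof.
move=> Ou.
set B := N%:R^-1 *: \matrix_n pderiv [::] (gfun X (lift ord0 n)) (theta u).
exists (D%:R * (enorm B * N%:R) / mono_const).
  apply: divr_ge0; last exact: ltW mono_const_gt0.
  by rewrite mulr_ge0// mulr_ge0// enorm_ge0.
move=> u' Ou'; set q := theta u' - theta u.
apply: le_trans (mxnorm_le_enorm _) _.
have := G_monotone Ou' (theta_hull Ou') (theta_hull Ou).
have -> : G X (theta u') u' - G X (theta u) u' = - Gdir [::] (theta u) (u' - u).
  rewrite (adm_root admX Ou') sub0r; congr (- _).
  have -> : G X (theta u) u' = Gpart [::] (theta u) (u + (u' - u)).
    by rewrite [u + _]addrC subrK.
  have Gu : Gpart [::] (theta u) u = 0 := adm_root admX Ou.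
  by rewrite GpartD Gu add0r.
rewrite -/q => h.
have h2 := enorm_cs q^T (- Gdir [::] (theta u) (u' - u))^T.
rewrite trmxK !enorm_trmx in h2.
have {}h := le_trans h h2.
have qle : mono_const * enorm q <= enorm (Gdir [::] (theta u) (u' - u)).
  have [q0|q0] := eqVneq (enorm q) 0; first by rewrite q0 mulr0 enorm_ge0.
  have qp : 0 < enorm q by rewrite lt_def q0 enorm_ge0.
  rewrite -(ler_pM2l qp); move: h; rewrite -scaleN1r enormZ normrN normr1 mul1r.
  by apply: le_trans; rewrite expr2 mulrCA.
rewrite mulrAC ler_pdivlMr ?mono_const_gt0// mulrC; apply: le_trans qle _.
apply: le_trans (enorm_le_mxnorm _) _; rewrite mul1n -mulrA ler_wpM2l//.
by rewrite GdirE; exact: mulmx_norm_bound.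
Qed.

Lemma theta_continuous u : Ow u -> {for u, continuous theta}.
Proof.
move=> Ou; have [K K0 KP] := theta_lipschitz Ou.
apply/(@cvgrPdist_le _ _ _ (nbhs u)) => e e0.
have K1 : 0 < K + 1 by rewrite ltr_wpDl.
have eK0 : 0 < e / (K + 1) by rewrite divr_gt0.
have uO := near_open Ow_open Ou.
have ue : \forall y \near u, `|y - u| < e / (K + 1).
  by apply/near_normP; exists (e / (K + 1)).
apply: filterS (filterI uO ue) => y [Oy yu].
rewrite distrC; apply: le_trans (KP y Oy) _.
apply: (@le_trans _ _ ((K + 1) * (e / (K + 1)))); last first.
  by rewrite mulrC divfK ?gt_eqF.
by apply: ler_pM => //; [rewrite lerDl|exact: ltW].
Qed.

(** Subtracting the equation at [u] from the one at [u + h] and expanding to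
    first order gives [q A^T + h B = o(h)] for [q = theta (u + h) - theta u],
    because [q = O(h)]; multiply by the inverse of [A]. *)
Lemma theta_differentiable u : Ow u -> differentiable theta u /\
  forall v, 'd theta u v =
    - (Gdir [::] (theta u) v *m (invmx (H X (theta u) u))^T).
Proof.
move=> Ou; set th := theta u; set A := H X th u.
have Oth : Ot th := hull_sub (theta_hull Ou).
have Au : A \in unitmx := coercive_unitmx mono_const_gt0 (H_coercive Ou Oth).
set B := N%:R^-1 *: \matrix_n pderiv [::] (gfun X (lift ord0 n)) th.
suff tB : forall e : R, 0 < e -> \forall h \near (0 : 'rV[R]_N),
     `|theta (h + u) - theta u - h *m (- (B *m (invmx A)^T))| <= e * `|h|.
  have [dt dtE] := differentiable_of_smallo_mx tB; split=> // v.
  by rewrite dtE GdirE mulmxN mulmxA.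
move=> e e0.
have [L L0 LP] := theta_lipschitz Ou.
pose K := enorm (invmx A)^T * D%:R.
have K0 : 0 <= K by rewrite mulr_ge0 ?enorm_ge0.
have K1 : 0 < K + 1 by rewrite ltr_wpDl.
have L1 : 0 < L + 1 by rewrite ltr_wpDl.
(* e1 handles the first-order remainder of G_u, which is o(theta (u + h) -
   theta u) and so loses the factor L; e2 handles the variation of the g_n. *)
pose e2 := e / 2 / (K + 1); pose e1 := e2 / (L + 1).
have e20 : 0 < e2 by rewrite !divr_gt0.
have e10 : 0 < e1 by rewrite divr_gt0.
have GdA v : 'd (G X ^~ u) th v = v *m A^T.
  rewrite diffE_row; last exact: (@Gpart_differentiable [::]).
  apply/rowP => i; rewrite summxE mxE; apply: eq_bigr => j _.
  by rewrite [A^T j i]mxE HE// -(@Gpart_derive [::])// mxE.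
have thc (P : 'rV[R]_D -> Prop) : (\forall y \near th, P y) ->
    \forall h \near (0 : 'rV[R]_N), P (theta (h + u)).
  move=> thP; apply: (@near_translate _ _ u (fun y => P (theta y))).
  by have tc := theta_continuous Ou; exact: (tc P thP).
have r1P : \forall h \near (0 : 'rV[R]_N),
    `|G X (theta (h + u)) u - (theta (h + u) - th) *m A^T|
      <= e1 * `|theta (h + u) - th|.
  apply: (thc (fun y => `|G X y u - (y - th) *m A^T| <= e1 * `|y - th|)).
  have Gd : differentiable (G X ^~ u) th by exact: (@Gpart_differentiable [::]).
  apply: filterS (differentiable_smallo Gd e10) => y.
  by rewrite GdA (adm_root admX Ou) subr0.
have r2P : \forall h \near (0 : 'rV[R]_N), forall n,
    `|gfun X n (theta (h + u)) - gfun X n th| <= e2.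
  apply: (thc (fun y => forall n, `|gfun X n y - gfun X n th| <= e2)).
  suff gn n : \forall y \near th, `|gfun X n y - gfun X n th| <= e2.
    exact: (filter_forall _ gn).
  have gc : {for th, continuous (gfun X n)}.
    by apply: differentiable_continuous; exact: (@g_differentiable n [::]).
  have /cvgrPdist_le/(_ _ e20) := gc.
  by apply: filterS => y; rewrite distrC.
have OP : \forall h \near (0 : 'rV[R]_N), Ow (h + u).
  by apply: near_translate; exact: near_open Ow_open Ou.
apply: filterS (filterI OP (filterI r1P r2P)) => h [Ohu [r1 r2]].
set q := theta (h + u) - th in r1 *.
set r := (G X (theta (h + u)) u - q *m A^T) +
         (Gdir [::] (theta (h + u)) h - Gdir [::] th h).
have rE : q *m A^T + h *m B = - r.
  rewrite -GdirE /r.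
  have : Gpart [::] (theta (h + u)) (u + h) = 0.
    by rewrite [u + h]addrC; exact: (adm_root admX Ohu).
  rewrite GpartD => /eqP; rewrite addr_eq0 => /eqP Gh.
  have -> : G X (theta (h + u)) u = - Gdir [::] (theta (h + u)) h by [].
  rewrite opprD !opprB !opprK.
  by rewrite addrACA subrr addr0.
have -> : q - h *m - (B *m (invmx A)^T) = - (r *m (invmx A)^T).
  rewrite mulmxN opprK mulmxA -mulNmx -rE mulmxDl; congr (_ + _).
  by rewrite -mulmxA -trmx_mul mulVmx// trmx1 mulmx1.
rewrite normrN; apply: le_trans (mulmx_norm_bound _ _) _.
have r1le : `|G X (theta (h + u)) u - q *m A^T| <= e2 * `|h|.
  apply: le_trans r1 _; rewrite /e1 -mulrA ler_pM2l// ler_pdivrMl//.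
  have := LP _ Ohu; rewrite addrK => /le_trans; apply.
  by rewrite ler_wpM2r// lerDl.
have r2le : `|Gdir [::] (theta (h + u)) h - Gdir [::] th h| <= e2 * `|h|.
  rewrite /Gdir -scalerBr -sumrB normrZ ger0_norm ?invr_ge0//.
  rewrite ler_pdivrMl; last by rewrite lt_def N0 ler0n.
  apply: le_trans (ler_norm_sum _ _ _) _.
  apply: (@le_trans _ _ (\sum_(n < N) e2 * `|h|)).
    apply: ler_sum => n _; rewrite -scalerBr normrZ mulrC.
    by apply: ler_pM => //; [exact: r2|exact: entry_le_mxnorm].
  by rewrite sumr_const card_ord mulr_natl.
apply: (@le_trans _ _ (K * (2 * (e2 * `|h|)))).
  apply: ler_wpM2l => //; apply: le_trans (ler_normD _ _) _; lra.
have -> : K * (2 * (e2 * `|h|)) = (K / (K + 1)) * (e * `|h|).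
  by rewrite /e2; field; rewrite gt_eqF.
rewrite ler_piMl ?mulr_ge0 ?(ltW e0)//.
by rewrite ler_pdivrMr// mul1r lerDl.
Qed.

(** * The derivatives of the root map as values of expressions *)

Definition Hroot (u : 'rV[R]_N) : 'M[R]_D :=
  \matrix_(i, j) Gpart [:: j] (theta u) u 0 i.

Lemma HrootE u : Ow u -> Hroot u = H X (theta u) u.
Proof.
move=> Ou; apply/matrixP => i j.
by rewrite mxE HE//; exact: theta_root_in.
Qed.

Lemma Hroot_unitmx u : Ow u -> Hroot u \in unitmx.
Proof.
move=> Ou; rewrite HrootE//.
exact: coercive_unitmx mono_const_gt0 (H_coercive Ou (theta_root_in Ou)).
Qed.

Definition groot n s i (u : 'rV[R]_N) : R := pderiv s (gfun X n) (theta u) 0 i.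

Lemma Gpart_groot s i u : Gpart s (theta u) u 0 i =
  N%:R^-1 * (groot ord0 s i u + \sum_(n < N) u 0 n * groot (lift ord0 n) s i u).
Proof.
rewrite /Gpart !mxE summxE; congr (_ * (_ + _)).
by apply: eq_bigr => n _; rewrite mxE.
Qed.

Lemma Gdir_groot s i u v : Gdir s (theta u) v 0 i =
  N%:R^-1 * \sum_(n < N) v 0 n * groot (lift ord0 n) s i u.
Proof.
rewrite /Gdir !mxE summxE; congr (_ * _).
by apply: eq_bigr => n _; rewrite mxE.
Qed.

Lemma groot_continuous n s i u : (size s <= kIJ.+1)%N -> Ow u ->
  {for u, continuous (groot n s i)}.
Proof.
move=> sk Ou; apply: continuous_coord.
apply: (@continuous_comp _ _ _ theta (pderiv s (gfun X n))).
  exact: theta_continuous.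
by have [_ gc] := adm_smooth admX n; apply: gc => //; exact: theta_root_in.
Qed.

Lemma groot_differentiable n s i u : (size s <= kIJ)%N -> Ow u ->
  differentiable (groot n s i) u.
Proof.
move=> sk Ou; have [dt _] := theta_differentiable Ou.
apply: (@differentiable_comp _ _ _ _ (pderiv s (gfun X n) \o theta)
  (fun y : 'rV[R]_D => y 0 i)); last exact: differentiable_coord.
apply: differentiable_comp => //; apply: g_differentiable => //.
exact: theta_root_in.
Qed.

Lemma groot_derive n s i u v : (size s <= kIJ)%N -> Ow u ->
  is_derive u v (groot n s i)
    (\sum_j ('D_v theta u) 0 j * groot n (j :: s) i u).
Proof.
move=> sk Ou; have [dt _] := theta_differentiable Ou.
have dg : differentiable (pderiv s (gfun X n)) (theta u).
  by apply: g_differentiable => //; exact: theta_root_in.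
have : is_derive u v (pderiv s (gfun X n) \o theta)
    (\sum_j ('D_v theta u) 0 j *: pderiv (j :: s) (gfun X n) (theta u)).
  have dc := differentiable_comp dt dg.
  apply: DeriveDef; first exact: diff_derivable.
  by rewrite (deriveE _ dc) (diff_comp dt dg)/= (diffE_row _ dg) (deriveE _ dt).
move=> /(is_derive_entry i).
suff -> : (\sum_j ('D_v theta u) 0 j *:
      pderiv (j :: s) (gfun X n) (theta u)) 0 i =
    \sum_j ('D_v theta u) 0 j * groot n (j :: s) i u by [].
by rewrite summxE; apply: eq_bigr => j _; rewrite mxE.
Qed.

Section Eval.
Variables (V : Type) (vec : V -> 'rV[R]_N).
Local Notation expr := (expr D V).

Fixpoint interp (u : 'rV[R]_N) (e : expr) : R :=
  match e with
  | Val s i => Gpart s (theta u) u 0 i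
  | Dir v s i => Gdir s (theta u) (vec v) 0 i
  | HInv i j => cofinv (Hroot u) i j
  | Neg e => - interp u e
  | Add e1 e2 => interp u e1 + interp u e2
  | Mul e1 e2 => interp u e1 * interp u e2
  | Sum f => \sum_j interp u (f j)
  end.

Lemma interp_droot v i u : Ow u ->
  interp u (droot v i) = ('D_(vec v) theta u) 0 i.
Proof.
move=> Ou; have [dt dtE] := theta_differentiable Ou.
rewrite deriveE// dtE mxE [X in - X]mxE /=; congr (- _); apply: eq_bigr => j _.
by rewrite mulrC cofinvE ?Hroot_unitmx// HrootE// [_^T _ _]mxE.
Qed.

Lemma coord_is_derive n (u v : 'rV[R]_N) :
  is_derive u v (fun y : 'rV[R]_N => y 0 n) (v 0 n).
Proof. exact: is_derive_entry (is_derive_id u v). Qed.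

Lemma interp_dval v s i u : (size s <= kIJ)%N -> Ow u ->
  is_derive u (vec v) (interp ^~ (Val _ s i)) (interp u (dval v s i)).
Proof.
move=> sk Ou.
have -> : interp ^~ (Val V s i) = (fun u => N%:R^-1 *
   (groot ord0 s i u + \sum_(n < N) u 0 n * groot (lift ord0 n) s i u)).
  by apply/funext => y; exact: Gpart_groot.
have d n := groot_derive n i (vec v) sk Ou.
have dsum := is_derive_bigsum (fun n : 'I_N =>
  is_deriveM (coord_is_derive n u (vec v)) (d (lift ord0 n))).
apply: is_derive_eq (is_derive_mull N%:R^-1 (is_deriveD (d ord0) dsum)) _.
have -> : interp u (dval v s i) =
    \sum_j ('D_(vec v) theta u) 0 j * Gpart (j :: s) (theta u) u 0 i +
    Gdir s (theta u) (vec v) 0 i.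
  by congr (_ + _); apply: eq_bigr => j _; rewrite -interp_droot.
rewrite Gdir_groot big_split/= addrA mulrDr; congr (_ + _ * _); last first.
  by apply: eq_bigr => n _; rewrite mulrC.
under [RHS]eq_bigr do rewrite Gpart_groot mulrDr mulrDr.
rewrite mulrDr [RHS]big_split/= -sum_exchange_mul; congr (_ + _).
by rewrite mulr_sumr; apply: eq_bigr => j _; rewrite mulrCA.
Qed.

Lemma Val_differentiable s i u : (size s <= kIJ)%N -> Ow u ->
  differentiable (interp ^~ (Val _ s i)) u.
Proof.
move=> sk Ou; rewrite /=.
have -> : (fun u => Gpart s (theta u) u 0 i) = (fun u => N%:R^-1 *
   (groot ord0 s i u + \sum_(n < N) u 0 n * groot (lift ord0 n) s i u)).
  by apply/funext => y; exact: Gpart_groot.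
apply: differentiable_mull; apply: differentiableD.
  exact: groot_differentiable.
apply: differentiable_bigsum => n; apply: differentiableM.
  exact: differentiable_coord.
exact: groot_differentiable.
Qed.

Lemma Hroot_differentiable u i j : Ow u ->
  differentiable (fun u => Hroot u i j) u.
Proof.
move=> Ou; have -> : (fun u => Hroot u i j) = interp ^~ (Val _ [:: j] i).
  by apply/funext => y; rewrite mxE.
exact: Val_differentiable.
Qed.

(** The chain rule is applied to partial derivatives of the [g_n] of order at
    most [kIJ], which are of class C^1. *)
Lemma interp_is_derive v e u : has_order kIJ e -> Ow u ->
  is_derive u (vec v) (interp ^~ e) (interp u (dexpr v e)).
Proof.
move=> eo Ou; elim: e eo => /=.
- by move=> s i /andP[_ sk]; exact: (interp_dval v i sk Ou).
- move=> w s i sk.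
  have -> : (fun u => Gdir s (theta u) (vec w) 0 i) = (fun u => N%:R^-1 *
      \sum_(n < N) vec w 0 n * groot (lift ord0 n) s i u).
    by apply/funext => y; exact: Gdir_groot.
  have d n := groot_derive n i (vec v) sk Ou.
  apply: is_derive_eq (is_derive_mull N%:R^-1 (is_derive_bigsum
    (fun n => is_derive_mull (vec w 0 n) (d (lift ord0 n))))) _.
  transitivity (\sum_j ('D_(vec v) theta u) 0 j *
      Gdir (j :: s) (theta u) (vec w) 0 i).
    by under [RHS]eq_bigr do rewrite Gdir_groot; exact: sum_exchange_mul.
  by apply: eq_bigr => j _; rewrite -interp_droot.
- move=> i j _.
  pose dH := \matrix_(k, l) interp u (dval v [:: l] k).
  have -> : - (\sum_l (\sum_k cofinv (Hroot u) i k *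
      interp u (dval v [:: l] k)) * cofinv (Hroot u) l j) =
      - (cofinv (Hroot u) *m dH *m cofinv (Hroot u)) i j.
    rewrite mxE; congr (- _); apply: eq_bigr => l _; congr (_ * _).
    by rewrite mxE; apply: eq_bigr => k _; rewrite [dH _ _]mxE.
  apply: is_derive_cofinv => [k l||k l].
  + exact: Hroot_differentiable.
  + by apply: filterS (near_open Ow_open Ou) => y; exact: Hroot_unitmx.
  + rewrite mxE; have -> : (fun u => Hroot u k l) = interp ^~ (Val _ [:: l] k).
      by apply/funext => y; rewrite mxE.
    exact: interp_dval.
- by move=> e IH /IH ed; exact: is_deriveN.
- by move=> e1 IH1 e2 IH2 [/IH1 d1 /IH2 d2]; exact: is_deriveD.
- by move=> e1 IH1 e2 IH2 [/IH1 d1 /IH2 d2]; exact: is_deriveM.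
- by move=> f IH fo; apply: is_derive_bigsum => j; exact: IH.
Qed.

Lemma continuous_interp e u : has_order kIJ.+1 e -> Ow u ->
  {for u, continuous (interp ^~ e)}.
Proof.
move=> eo Ou; elim: e eo => /=.
- move=> s i /andP[_ sk].
  have -> : (fun u => Gpart s (theta u) u 0 i) = (fun u => N%:R^-1 *
     (groot ord0 s i u + \sum_(n < N) u 0 n * groot (lift ord0 n) s i u)).
    by apply/funext => y; exact: Gpart_groot.
  apply: continuous_mull.
  apply: continuousD; first exact: groot_continuous.
  apply: continuous_bigsum => n; apply: continuousM.
    exact: coord_continuous.
  exact: groot_continuous.
- move=> w s i sk.
  have -> : (fun u => Gdir s (theta u) (vec w) 0 i) = (fun u => N%:R^-1 *
      \sum_(n < N) vec w 0 n * groot (lift ord0 n) s i u).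
    by apply/funext => y; exact: Gdir_groot.
  apply: continuous_mull.
  apply: continuous_bigsum => n; apply: continuous_mull.
  exact: groot_continuous.
- move=> i j _; apply: differentiable_continuous.
  apply: differentiable_cofinv; last exact: Hroot_unitmx.
  by move=> k l; exact: Hroot_differentiable.
- by move=> e IH /IH ed; exact: continuousN.
- by move=> e1 IH1 e2 IH2 [/IH1 d1 /IH2 d2]; exact: continuousD.
- by move=> e1 IH1 e2 IH2 [/IH1 d1 /IH2 d2]; exact: continuousM.
- by move=> f IH fo; apply: continuous_bigsum => j; exact: IH.
Qed.

End Eval.

Lemma pderiv_droots s j u : (size s <= kIJ)%N -> Ow u ->
  pderiv (j :: s) theta u =
  \row_i interp (fun j => delta_mx 0 j) u (droots j s i).
Proof.
pose vec j : 'rV[R]_N := delta_mx 0 j.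
elim: s j u => [|l s IH] j u sk Ou.
  by apply/rowP => i; rewrite mxE (@interp_droot _ vec).
have near_row : \forall y \near u,
    \row_i interp vec y (droots l s i) = pderiv (l :: s) theta y.
  by apply: filterS (near_open Ow_open Ou) => y Oy; rewrite IH// ltnW.
have rd : is_derive u (vec j) (fun y => \row_i interp vec y (droots l s i))
    (\row_i interp vec u (dexpr j (droots l s i))).
  apply: is_derive_row => i; apply: interp_is_derive => //.
  by apply: has_orderW (has_order_droots l s i).
by have [_ <-] := near_eq_is_derive near_row rd.
Qed.

Lemma theta_Ck : Ck_on kIJ.+1 Ow theta.
Proof.
pose vec j : 'rV[R]_N := delta_mx 0 j.
have near_row l s u : (size s <= kIJ)%N -> Ow u -> \forall y \near u,
    \row_i interp vec y (droots l s i) = pderiv (l :: s) theta y.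
  move=> sk Ou.
  by apply: filterS (near_open Ow_open Ou) => y Oy; rewrite pderiv_droots.
split=> [[|l s] sk j u Ou|[|l s] sk u Ou].
- by have [dt _] := theta_differentiable Ou; exact: diff_derivable.
- apply: near_eq_derivable (near_row l s u (ltnW sk) Ou) _.
  suff rd : is_derive u (vec j) (fun y => \row_i interp vec y (droots l s i))
    (\row_i interp vec u (dexpr j (droots l s i))) by case: rd.
  apply: is_derive_row => i; apply: interp_is_derive => //.
  by apply: has_orderW (has_order_droots l s i).
- exact: theta_continuous.
- apply: near_eq_continuous (near_row l s u sk Ou) _.
  apply: continuous_row => i; apply: continuous_interp => //.
  by apply: has_orderW (has_order_droots l s i).
Qed.

(** With a single direction, named [tt], the expression depends on [k], [i] and
    the dimension [D] only. *)
Lemma dirderiv_droots k v u : (k <= kIJ)%N -> Ow u ->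
  dirderiv k.+1 v theta u =
  \row_i interp (fun=> v) u (droots tt (nseq k tt) i).
Proof.
elim: k u => [|k IH] u kk Ou.
  rewrite (dirderivS _ Ow_open theta_Ck)// dirderiv0.
  by apply/rowP => i; rewrite mxE (@interp_droot _ (fun=> v) tt).
rewrite (dirderivS _ Ow_open theta_Ck)//.
have near_row : \forall y \near u,
    \row_i interp (fun=> v) y (droots tt (nseq k tt) i) =
    dirderiv k.+1 v theta y.
  by apply: filterS (near_open Ow_open Ou) => y Oy; rewrite IH// ltnW.
have rd : is_derive u v
    (fun y => \row_i interp (fun=> v) y (droots tt (nseq k tt) i))
    (\row_i interp (fun=> v) u (dexpr tt (droots tt (nseq k tt) i))).
  apply: is_derive_row => i; apply: (@interp_is_derive _ (fun=> v) tt) => //.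
  apply: has_orderW (has_order_droots tt (nseq k tt) i).
  by rewrite size_nseq.
by have [_ <-] := near_eq_is_derive near_row rd.
Qed.

(** * Uniform bounds *)

Lemma delta_le_max k : (k <= kIJ.+1)%N -> delta_ X k <= delta_max X kIJ.
Proof.
move=> kk; have kk' : (k < kIJ.+2)%N by [].
exact: (@le_bigmax _ _ _ _ (fun j : 'I_kIJ.+2 => delta_ X j) (Ordinal kk')).
Qed.

Lemma delta_max_ge0 : 0 <= delta_max X kIJ.
Proof. exact: bigmax_ge_id. Qed.

Lemma interp_bound (V : Type) (vec : V -> 'rV[R]_N) e u :
  delta_max X kIJ <= 1 ->
  (forall v s i, (size s <= kIJ.+1)%N ->
     `|Gdir s (theta u) (vec v) 0 i| <= 1) ->
  has_order kIJ.+1 e -> Ow u ->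
  `|interp vec u e| <= ebound M mono_const e.
Proof.
move=> d1 dir1 eo Ou; elim: e eo => /=.
- move=> s i sk; apply: le_trans (Gpart_bound i sk Ou (theta_root_in Ou)) _.
  by rewrite lerD2l (le_trans (delta_le_max _))//; case/andP: sk.
- by move=> v s i sk; exact: dir1.
- move=> i j _; rewrite cofinvE ?Hroot_unitmx// HrootE//.
  exact: coercive_invmx mono_const_gt0 (H_coercive Ou (theta_root_in Ou)).
- by move=> e IH eo; rewrite normrN; exact: IH.
- move=> e1 IH1 e2 IH2 [/IH1 b1 /IH2 b2].
  exact: le_trans (ler_normD _ _) (lerD b1 b2).
- by move=> e1 IH1 e2 IH2 [/IH1 b1 /IH2 b2]; rewrite normrM; exact: ler_pM.
- move=> f IH fo; apply: le_trans (ler_norm_sum _ _ _) _.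
  by apply: ler_sum => j _; exact: IH.
Qed.

Definition dirbound k : R :=
  \sum_(p : 'I_1 * 'I_D) ebound M mono_const (droots tt (nseq k tt) p.2).

(** In the direction [Delta / eta] all directional atoms are at most
    [delta / eta <= 1]. The scale [eta] is kept apart from [delta] because
    [delta] may vanish. *)
Lemma dirderiv_bound_gt k u (eta : R) : (k <= kIJ)%N -> Ow u ->
  delta_max X kIJ <= 1 -> 0 < eta -> delta_max X kIJ <= eta ->
  enorm (dirderiv k.+1 (Delta_w X) theta u) <= dirbound k * eta ^+ k.+1.
Proof.
move=> kk Ou d1 e0 de.
have -> : Delta_w X = eta *: (eta^-1 *: Delta_w X).
  by rewrite scalerA divff ?gt_eqF// scale1r.
rewrite dirderivZ enormZ ger0_norm ?exprn_ge0 ?(ltW e0)// mulrC.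
apply: ler_wpM2r; first by rewrite exprn_ge0// ltW.
apply: le_trans (l2norm_le_sum _) _; apply: ler_sum => -[r i] _ /=.
rewrite [r]ord1 dirderiv_droots// mxE; apply: interp_bound => //.
  move=> _ s j sk; rewrite GdirE -scalemxAl -GdirE mxE normrM.
  rewrite ger0_norm ?invr_ge0 ?(ltW e0)// ler_pdivrMl// mulr1.
  apply: le_trans (Gdir_bound j sk (theta_root_in Ou)) _.
  exact: le_trans (delta_le_max sk) de.
apply: has_orderW (has_order_droots tt (nseq k tt) i).
by rewrite size_nseq.
Qed.

(** If [delta = 0], letting the scale [eta] tend to [0] shows that the
    derivative vanishes. *)
Lemma dirderiv_bound k u : (k <= kIJ)%N -> Ow u -> delta_max X kIJ <= 1 ->
  enorm (dirderiv k.+1 (Delta_w X) theta u)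
    <= dirbound k * delta_max X kIJ ^+ k.+1.
Proof.
move=> kk Ou d1; have [d0|d0] := eqVneq (delta_max X kIJ) 0; last first.
  apply: dirderiv_bound_gt => //.
  by rewrite lt_def d0 delta_max_ge0.
rewrite d0 expr0n mulr0; apply/ler_addgt0Pr => e e0; rewrite add0r.
have K0 : 0 <= dirbound k.
  have := @dirderiv_bound_gt k u 1 kk Ou d1 ltr01 d1.
  by rewrite expr1n mulr1; apply: le_trans; exact: enorm_ge0.
have K1 : 0 < dirbound k + 1 by rewrite ltr_wpDl.
pose eta := Num.min 1 (e / (dirbound k + 1)).
have eta0 : 0 < eta by rewrite lt_min ltr01 divr_gt0.
apply: le_trans (@dirderiv_bound_gt k u eta kk Ou d1 eta0 _) _.
  by rewrite d0 ltW.
apply: (@le_trans _ _ (dirbound k * eta)).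
  apply: ler_wpM2l => //; rewrite exprS ler_piMr ?(ltW eta0)//.
  by rewrite exprn_ile1 ?(ltW eta0)// ge_min lexx.
apply: (@le_trans _ _ ((dirbound k + 1) * (e / (dirbound k + 1)))).
  by apply: ler_pM => //; [exact: ltW|rewrite lerDl|rewrite ge_min lexx orbT].
by rewrite mulrC divfK ?gt_eqF.
Qed.

Lemma theta_IJ_error k (B : R) : (k <= kIJ)%N ->
  (forall u, Ow u -> enorm (dirderiv k.+1 (Delta_w X) theta u) <= B) ->
  enorm (theta_IJ X k - theta (wgt X)) <= D%:R * B.
Proof.
move=> kk dB; set v := Delta_w X.
pose f i j (t : R) := dirderiv j v theta (ones X + t *: v) 0 i.
have w1 : wgt X = ones X + 1 *: v by rewrite scale1r /v /Delta_w addrC subrK.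
have fd i j (t : R) : (j < k.+1)%N -> 0 <= t <= 1 ->
    is_derive t 1 (f i j) (f i j.+1 t).
  move=> jk t01; have Ot1 := Ow_segment t01.
  have jK : (j < kIJ.+1)%N by apply: leq_trans jk _.
  rewrite /f (dirderivS _ Ow_open theta_Ck jK Ot1).
  apply: is_derive_entry; apply: (is_derive_line (f := dirderiv j v theta)).
  apply: diff_derivable.
  exact: (dirderiv_differentiable _ Ow_open theta_Ck jK Ot1).
have fB i (t : R) : 0 <= t <= 1 -> `|f i k.+1 t| <= B.
  by move=> t01; apply: le_trans (normr_le_enorm _ _ _) (dB _ (Ow_segment t01)).
have entry i : `|(theta_IJ X k - theta (wgt X)) 0 i| <= B.
  have := taylor_bound (fd i) (fB i) (t := 1); rewrite ler01 lexx => /(_ isT).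
  rewrite distrC; congr (`|_| <= _).
  rewrite [in RHS]mxE [X in _ = _ + X]mxE /f dirderiv0 -w1; congr (_ - _).
  rewrite big_ord_recl /= fact0 invr1 expr0 !mul1r scale0r addr0 dirderiv0 mxE.
  congr (_ + _); rewrite big_add1 /= big_mkord summxE; apply: eq_bigr => j _.
  by rewrite [RHS]mxE expr1n mulr1.
apply: le_trans (l2norm_le_sum _) _.
apply: (@le_trans _ _ (\sum_(p : 'I_1 * 'I_D) B)).
  by apply: ler_sum => -[r i] _; rewrite [r]ord1; exact: entry.
by rewrite sumr_const card_prod !card_ord mul1n mulr_natl.
Qed.

End Instance.

Theorem theorem1 (R : realType) (D : nat) (hD : (1 <= D)%N)
    (kIJ : nat) (hkIJ : (1 <= kIJ)%N) (Cop rho : R) (M : nat -> R)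
    (hCop : 0 < Cop) (hrho : 0 < rho < 1)
    (hM : forall k, (1 <= k <= kIJ.+1)%N -> 0 <= M k) :
  (forall X : instance R D, admissible X kIJ Cop rho M ->
     Ck_on kIJ.+1 (Omega_w X) (theta_hat X)) /\
  (forall k : nat, (k <= kIJ)%N ->
     exists K d0 : R, 0 < d0 /\
       forall X : instance R D, admissible X kIJ Cop rho M ->
         delta_max X kIJ <= d0 ->
         (ereal_sup [set (enorm (dirderiv k.+1 (Delta_w X) (theta_hat X) u))%:E
                    | u in Omega_w X]
            <= (K * delta_max X kIJ ^+ k.+1)%:E)%E /\
         enorm (theta_IJ X k - theta_hat X (wgt X))
            <= K * delta_max X kIJ ^+ k.+1).
Proof.
split=> [X admX|k kk]; first exact: theta_Ck hCop hrho hkIJ hM admX.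
exists (D%:R * dirbound D Cop rho M k), 1; split=> // X admX d1.
have dB u : Omega_w X u ->
    enorm (dirderiv k.+1 (Delta_w X) (theta_hat X) u)
      <= dirbound D Cop rho M k * delta_max X kIJ ^+ k.+1.
  by move=> Ou; apply: dirderiv_bound hCop hrho hkIJ hM admX _ _ kk Ou d1.
split; last first.
  by rewrite -mulrA; apply: theta_IJ_error hCop hrho hkIJ hM admX _ _ kk dB.
apply: ge_ereal_sup => _ [u Ou <-]; rewrite lee_fin -mulrA.
apply: le_trans (dB u Ou) _; rewrite ler_peMl ?ler1n//.
exact: le_trans (enorm_ge0 _) (dB u Ou).
Qed.
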